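(* $K(P_m)\subset\Sigma_\pi$ and $K(P_m^* )\subset\Sigma_\pi$, for every integer $m\ge2$.
   Context: For $k=(k_1,\dots,k_n)\in\{\pm1\}^n$ and $1\le i\le j\le n$, let $k(i:j):=(k_i,\dots,k_j)$ and let $q_{k(i:j)}(\lambda)$ be the determinant of the tridiagonal matrix of order $j-i+2$ with all main diagonal entries equal to $\lambda$, all entries on the first superdiagonal equal to $1$, and first subdiagonal entries $k_i,\dots,k_j$ (from top to bottom). Further set $q_{k(i:j)}(\lambda):=\lambda$ if $i-j=1$, $:=1$ if $i-j=2$, and $:=0$ if $i-j=3$. For $k\in\{\pm1\}^n$ the polynomial $p_k$ is defined by $(-1)^n p_k(\lambda)=q_{k(1:n-1)}(-\lambda)-k_n\,q_{k(2:n-2)}(-\lambda)$. For $m\ge2$, $P_m$ is the polynomial $p_k$ for the vector $k$ of length $m$ with $k_{m-1}=-1$, $k_m=1$ and all other entries equal to $1$; equivalently $P_m(\lambda)=\lambda U_{m-1}(\lambda/2)$, with $U_n$ the Chebyshev polynomial of the second kind of degree $n$. $P_m^*$ is the polynomial $p_k$ for the vector $k$ of length $m$ with $k_{m-1}=-1$, $k_m=1$ and all other entries equal to $-1$; equivalently $P_m^*(\lambda)=\mathrm{i}^{-m}P_m(\mathrm{i}\lambda)$. For $c\in\{\pm1\}^{\mathbb{Z}}$ let $A_c$ be the bounded operator on $\ell^2(\mathbb{Z})$ given by $(A_c\phi)_m=c_m\phi_{m-1}+\phi_{m+1}$. $\pi_\infty$ is the union of the spectra (on $\ell^2(\mathbb{Z})$)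 of $A_c$ over all periodic $c\in\{\pm1\}^{\mathbb{Z}}$, and $\Sigma_\pi:=\overline{\pi_\infty}\subset\mathbb{C}$. The filled Julia set $K(p)$ of a polynomial $p$ of degree $\ge2$ is the set of $z\in\mathbb{C}$ for which the sequence of iterates $(p^n(z))_{n\in\mathbb{N}}$ ($p^n$ the $n$-fold composition) is bounded. *)

(* Defs.v *)
From HB Require Import structures.
From mathcomp Require Import all_boot all_order all_algebra.
From mathcomp Require Import complex.
From mathcomp Require Import all_classical all_reals all_analysis.

Set Implicit Arguments.
Unset Strict Implicit.
Unset Printing Implicit Defensive.

Import Order.TTheory GRing.Theory Num.Theory.
Import numFieldNormedType.Exports.

Local Open Scope classical_set_scope.
Local Open Scope ring_scope.

Section Polynomials.
Variable R : realType.
Local Notation C := (R[i]).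

(* Indexing is 1-based, as for k = (k_1, ..., k_n): a vector of length n is
   given by a function on int of which only the values at 1, ..., n are used. *)

(* The matrix of order n with 'X on the diagonal, 1 on the superdiagonal, and
   k_i, k_(i+1), ... on the subdiagonal; its rows and columns are 0-based. *)
Definition tridiag_mx (k : int -> int) (i : int) (n : nat) : 'M[{poly C}]_n :=
  \matrix_(r < n, s < n)
    (if r == s then 'X
     else if s == r.+1 :> nat then 1
     else if r == s.+1 :> nat then (k (i + s%:Z))%:~R
     else 0).

(* q_{k(i:j)}; not meaningful for j < i - 3. *)
Definition q_poly (k : int -> int) (i j : int) : {poly C} :=
  if i - j == 1 then 'X
  else if i - j == 2 then 1
  else if i - j == 3 then 0
  else \det (tridiag_mx k i (absz (j - i + 2))).

(* Multiplying by (-1)^n solves the defining equation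
   (-1)^n p_k(x) = q_{k(1:n-1)}(-x) - k_n q_{k(2:n-2)}(-x). *)
Definition p_poly (n : nat) (k : int -> int) : {poly C} :=
  (-1) ^+ n * ((q_poly k 1 (n%:Z - 1)) \Po (- 'X)
               - (k n%:Z)%:~R * ((q_poly k 2 (n%:Z - 2)) \Po (- 'X))).

(* (s, ..., s, -1, 1), of length m. *)
Definition P_vec (s : int) (m : nat) (i : int) : int :=
  if i == m%:Z - 1 then -1 else if i == m%:Z then 1 else s.

Definition P_poly (m : nat) : {poly C} := p_poly m (P_vec 1 m).

Definition Pstar_poly (m : nat) : {poly C} := p_poly m (P_vec (-1) m).

Definition filled_julia (p : {poly C}) : set C :=
  [set z : C | [bounded (iter n (horner p) z : C^o) | n in [set: nat]]].

End Polynomials.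

Section Spectrum.
Variable R : realType.
Local Notation C := (R[i]).

Definition l2_sqsum (phi : int -> C) : \bar R :=
  (\esum_(m in [set: int]) ((Normc.normc (phi m)) ^+ 2)%R%:E)%E.

Definition l2 : set (int -> C) := [set phi | (l2_sqsum phi < +oo)%E].

Definition l2norm (phi : int -> C) : R := Num.sqrt (fine (l2_sqsum phi)).

(* An operator on l^2(Z) is a map on all sequences, of which only the values on
   l^2(Z) are used. *)
Definition bounded_operator (B : (int -> C) -> (int -> C)) : Prop :=
  [/\ forall phi, l2 phi -> l2 (B phi),
      forall (a : C) phi psi, l2 phi -> l2 psi ->
        B (fun m => a * phi m + psi m) = (fun m => a * B phi m + B psi m)
    & exists M : R, forall phi, l2 phi -> l2norm (B phi) <= M * l2norm phi].

Definition resolvent_set (A : (int -> C) -> (int -> C)) : set C :=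
  [set lam | exists2 B, bounded_operator B &
     forall phi, l2 phi ->
       B (fun m => A phi m - lam * phi m) = phi /\
       (fun m => A (B phi) m - lam * B phi m) = phi].

Definition spectrum (A : (int -> C) -> (int -> C)) : set C :=
  ~` resolvent_set A.

Definition hopping (c : int -> int) (phi : int -> C) : int -> C :=
  fun m => (c m)%:~R * phi (m - 1) + phi (m + 1).

Definition sign_sequence (c : int -> int) : Prop :=
  forall m, c m = 1 \/ c m = -1.

Definition periodic (c : int -> int) : Prop :=
  exists2 N : nat, (0 < N)%N & forall m, c (m + N%:Z) = c m.

Definition pi_infty : set C :=
  \bigcup_(c in [set c | sign_sequence c /\ periodic c]) spectrum (hopping c).

Definition Sigma_pi : set C := closure (pi_infty : set C^o).

End Spectrum.

Arguments P_poly R m : clear implicits.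
Arguments Pstar_poly R m : clear implicits.
Arguments pi_infty R : clear implicits.
Arguments Sigma_pi R : clear implicits.

(* Main.v *)
Require Import Defs.
From mathcomp Require Import all_boot all_order all_algebra.
From mathcomp Require Import cyclic separable cyclotomic.
From mathcomp Require Import complex polyrcf ring lra zify.
From mathcomp Require Import all_classical all_reals all_analysis.

(* Write U_n for the Chebyshev polynomials with P_m(x) = x U_m(x), so U_0 = 0,
   U_1 = 1, U_(n+2) = x U_(n+1) - U_n, and let Sg be the closure of the set of
   all lam for which some periodic A_c has a bounded eigenvector; Sg lies in
   Sigma_pi.

   Replacing each entry of a periodic sequence by a block of length m shows
   that P_m^-1(Sg) is contained in Sg.  As Sg contains [-2, 2] and i Sg = Sg,
   taking square roots (P_2 = x^2) gives the unit disc, and the preimages of the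
   disc under the P_k with P_k(2 cos t) = 2 cos t sin (k t) / sin t give a
   neighbourhood of (-2, 2).

   In the variable s = x^2 both P_m and P_m^* become polynomials G with real
   coefficients and real roots, hence with real critical points.  Therefore
   |G'(x + i t)| increases with |t|, and |Im G(s)| < |Im s| |G'(s)| off the real
   line.  A bounded orbit outside Sg stays away from the real line, so that
   |(G^n)'(s)| tends to infinity along it.  But a disc around s avoids Sg, hence
   so do its iterates; they avoid the unit disc, and Cauchy's estimate for 1/G^n
   bounds |(G^n)'(s)|.  *)

Set Implicit Arguments.
Unset Strict Implicit.
Unset Printing Implicit Defensive.

Import Order.TTheory GRing.Theory Num.Theory.
Import numFieldNormedType.Exports.

Local Open Scope classical_set_scope.
Local Open Scope ring_scope.

Local Notation nc := (@Normc.normc _).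

(** * The modulus on [R[i]] as a real number *)

Section ComplexModulus.
Variable R : rcfType.
Local Notation C := R[i].
Implicit Types (x y z : C) (a b : R).

Lemma normcE z : `|z| = (nc z)%:C%C. Proof. by []. Qed.

Lemma nc_ge0 z : 0 <= nc z.
Proof. by case: z => a b; rewrite sqrtr_ge0. Qed.

Lemma nc_sqr z : nc z ^+ 2 = complex.Re z ^+ 2 + complex.Im z ^+ 2.
Proof. by case: z => a b /=; rewrite sqr_sqrtr // addr_ge0 ?sqr_ge0. Qed.

Lemma ncM x y : nc (x * y) = nc x * nc y. Proof. exact: Normc.normcM. Qed.

Lemma ncV x : nc x^-1 = (nc x)^-1. Proof. exact: Normc.normcV. Qed.

Lemma nc_real a : nc (a%:C%C) = `|a|.
Proof. by rewrite /= expr0n addr0 sqrtr_sqr. Qed.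

Lemma nc0 : nc (0 : C) = 0. Proof. exact: Normc.normc0. Qed.

Lemma nc1 : nc (1 : C) = 1. Proof. exact: Normc.normc1. Qed.

Lemma nci : nc ('i%C : C) = 1.
Proof. by rewrite /= expr0n add0r expr1n sqrtr1. Qed.

Lemma nc_eq0 z : (nc z == 0) = (z == 0).
Proof.
by apply/eqP/eqP => [/Normc.eq0_normc//|->]; rewrite nc0.
Qed.

Lemma nc_gt0 z : (0 < nc z) = (z != 0).
Proof. by rewrite lt_neqAle nc_ge0 andbT eq_sym nc_eq0. Qed.

Lemma ncN z : nc (- z) = nc z.
Proof. by case: z => a b /=; rewrite !sqrrN. Qed.

Lemma ncD x y : nc (x + y) <= nc x + nc y.
Proof. by rewrite -lecR rmorphD /= -!normcE ler_normD. Qed.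

Lemma ncB x y : nc (x - y) <= nc x + nc y.
Proof. by rewrite (le_trans (ncD _ _)) // ncN. Qed.

Lemma nc_distC x y : nc (x - y) = nc (y - x).
Proof. by rewrite -ncN opprB. Qed.

Lemma nc_dist x y : nc x - nc y <= nc (x - y).
Proof. by rewrite lerBlDr (le_trans _ (ncD _ _)) // subrK. Qed.

Lemma ncX z n : nc (z ^+ n) = nc z ^+ n.
Proof. by elim: n => [|n IHn]; rewrite ?nc1 // !exprS ncM IHn. Qed.

Lemma nc_sum (I : Type) (r : seq I) (P : pred I) (f : I -> C) :
  nc (\sum_(i <- r | P i) f i) <= \sum_(i <- r | P i) nc (f i).
Proof.
elim/big_ind2: _ => [|x1 y1 x2 y2 h1 h2|//]; first by rewrite nc0.
by rewrite (le_trans (ncD _ _)) // lerD.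
Qed.

Lemma nc_prod (I : Type) (r : seq I) (P : pred I) (f : I -> C) :
  nc (\prod_(i <- r | P i) f i) = \prod_(i <- r | P i) nc (f i).
Proof. by apply: (big_morph nc ncM nc1). Qed.

Lemma abs_Re_le_nc z : `|complex.Re z| <= nc z.
Proof.
rewrite -(@ler_pXn2r _ 2) ?nnegrE ?nc_ge0 // nc_sqr real_normK ?num_real //.
by rewrite lerDl sqr_ge0.
Qed.

Lemma abs_Im_le_nc z : `|complex.Im z| <= nc z.
Proof.
rewrite -(@ler_pXn2r _ 2) ?nnegrE ?nc_ge0 // nc_sqr real_normK ?num_real //.
by rewrite lerDr sqr_ge0.
Qed.

Lemma nc_nat n : nc (n%:R : C) = n%:R.
Proof.
by rewrite (_ : n%:R = (n%:R : R)%:C%C) ?nc_real ?normr_nat // rmorph_nat.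
Qed.

End ComplexModulus.

(** * Mean values of polynomials over roots of unity *)

Section PolynomialMean.
Variable R : rcfType.
Local Notation C := R[i].
Implicit Types (p q : {poly C}) (x y z : C).

Lemma exists_prim_root (F : numClosedFieldType) n :
  (n > 0)%N -> exists z : F, n.-primitive_root z.
Proof.
pose p : {poly F} := 'X^n - 1; have [r Dp] := closed_field_poly_normal p.
move=> n_gt0; rewrite (monicP _) ?monicXnsubC // scale1r in Dp.
have rn1: all n.-unity_root r by apply/allP=> z; rewrite -root_prod_XsubC -Dp.
have sz_r: (n < (size r).+1)%N.
  by rewrite -(size_prod_XsubC r id) -Dp size_XnsubC.
have [|z _ hz] := hasP (has_prim_root n_gt0 rn1 _ sz_r); last by exists z.
by rewrite -separable_prod_XsubC -Dp separable_Xn_sub_1 // pnatr_eq0 -lt0n.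
Qed.

Lemma sum_prim_root (F : fieldType) N (w : F) j : N.-primitive_root w ->
  (0 < j < N)%N -> \sum_(k < N) (w ^+ k) ^+ j = 0.
Proof.
move=> hw /andP[j0 jN].
have wj1 : w ^+ j - 1 != 0.
  rewrite subr_eq0 -(expr0 w) (eq_prim_root_expr hw) mod0n modn_small //.
  by rewrite -lt0n.
apply: (mulfI wj1); rewrite mulr0.
under eq_bigr => k _ do rewrite exprAC.
by rewrite -subrX1 exprAC (prim_expr_order hw) expr1n subrr.
Qed.

(** A discrete form of Cauchy's integral formula: summing over the N-th roots of unity kills every
    monomial of degree strictly between 0 and N. *)
Lemma poly_mean p N (w t : C) : N.-primitive_root w -> (size p <= N)%N ->
  \sum_(k < N) p.[t * w ^+ k] = p.[0] *+ N.
Proof.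
move=> hw hN.
under eq_bigr => k _ do rewrite (horner_coef_wide _ hN).
rewrite exchange_big /=.
case: N hw hN => [/prim_order_gt0//|N] hw hN.
rewrite big_ord_recl /= [X in _ + X]big1 ?addr0.
  under eq_bigr => k _ do rewrite expr0 mulr1.
  by rewrite sumr_const card_ord horner_coef0.
move=> j _.
under eq_bigr => k _ do rewrite exprMn mulrA.
by rewrite -big_distrr /= (sum_prim_root hw) ?mulr0 //= /bump /= add1n ltnS.
Qed.

Lemma poly_center_bound p (t B : R) : 0 <= t ->
  (forall x, nc x = t -> nc p.[x] <= B) -> nc p.[0] <= B.
Proof.
move=> t0 hB; have [w hw] := @exists_prim_root C (size p).+1 isT.
have h := poly_mean t%:C%C hw (leqnSn _).
have hw1 k : nc (w ^+ k) = 1.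
  apply/eqP; rewrite -(@pexpr_eq1 _ _ (size p).+1) ?nc_ge0 //.
  by rewrite -ncX exprAC (prim_expr_order hw) expr1n nc1.
suff : nc p.[0] * (size p).+1%:R <= B * (size p).+1%:R by rewrite ler_pM2r.
rewrite -nc_nat -ncM mulr_natr -h.
apply: le_trans (nc_sum _ _ _) _.
rewrite nc_nat mulr_natr -[leRHS](_ : \sum_(k < (size p).+1) B = _).
  apply: ler_sum => k _; apply: hB.
  by rewrite ncM hw1 mulr1 nc_real ger0_norm.
by rewrite sumr_const card_ord.
Qed.
End PolynomialMean.

(** * Cauchy's estimate for the reciprocal of a polynomial *)

Section CauchyEstimate.
Variable R : realType.
Local Notation C := R[i].
Implicit Types (p q : {poly C}) (x y z : C).

Lemma exists_expr_lt (a e : R) : 0 <= a < 1 -> 0 < e -> exists n, a ^+ n <= e.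
Proof.
move=> /andP[a0 a1] e0.
have /cvgrPdist_lt /(_ _ e0) [n _ /(_ n (leqnn _)) /=] : a ^+ n @[n --> \oo] --> 0.
  by apply: cvg_expr; rewrite ger0_norm.
rewrite sub0r normrN => h; exists n; apply: ltW.
exact: le_lt_trans (ler_norm _) h.
Qed.

(** The mean value bound is available for polynomials only, so the reciprocal of a product without
    zeros in the disc is approximated by one: each factor 1/(x - b) is replaced by a truncated
    geometric series in x/b. *)
Lemma approx_inv_prod (t e : R) (s : seq C) : 0 <= t -> 0 < e ->
  all (fun b => t < nc b) s ->
  exists g, forall x, nc x <= t ->
    nc (g.[x] * (\prod_(b <- s) (x - b)) - 1) <= e.
Proof.
move=> t0; elim: s e => [|b s IHs] e e0 /=.
  by exists 1 => x _; rewrite big_nil hornerC mulr1 subrr nc0 ltW.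
move=> /andP[tb /IHs {}IHs].
(* The final error has three terms, each of size at most [d], one of them a product that needs
   [d <= 1]. *)
pose d := Num.min 1 (e / 3).
have d0 : 0 < d by rewrite lt_min ltr01 /= divr_gt0.
have d1 : d <= 1 by rewrite ge_min lexx.
have d3 : 3 * d <= e by rewrite mulrC -ler_pdivlMr // ge_min lexx orbT.
have [g hg] := IHs _ d0.
have b0 : b != 0 by rewrite -nc_gt0 (le_lt_trans t0).
have bp : 0 < nc b by rewrite nc_gt0.
have [L hL] : exists L, (t / nc b) ^+ L <= d.
  by apply: exists_expr_lt => //; rewrite divr_ge0 ?nc_ge0 //= ltr_pdivrMr ?mul1r.
pose f : {poly C} := (- b^-1)%:P * \sum_(j < L) (b^-1 *: 'X) ^+ j.
have hf x : f.[x] * (x - b) = 1 - (x / b) ^+ L.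
  rewrite /f hornerM hornerC horner_sum.
  under eq_bigr => j _ do rewrite horner_exp hornerZ hornerX.
  rewrite -[RHS]opprB subrX1 mulrAC.
  under [in RHS]eq_bigr => j _ do rewrite [x / b]mulrC.
  by rewrite -mulNr; congr (_ * _); field.
exists (f * g) => x hx.
rewrite big_cons hornerM mulrACA hf.
set u := _ ^+ L; set v := g.[x] * _.
have -> : (1 - u) * v - 1 = (v - 1) - u * (v - 1) - u by ring.
have hu : nc u <= d.
  rewrite (le_trans _ hL) // /u ncX ncM ncV; apply: lerXn2r; rewrite ?nnegrE.
  - by rewrite divr_ge0 ?nc_ge0.
  - by rewrite divr_ge0 ?nc_ge0.
  by rewrite ler_pM2r ?invr_gt0.
have hv : nc (v - 1) <= d by apply: hg.
have := ncB (v - 1 - u * (v - 1)) u; have := ncB (v - 1) (u * (v - 1)).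
rewrite ncM => h1 h2.
have h3 : nc u * nc (v - 1) <= d by rewrite -[d]mul1r ler_pM ?nc_ge0 ?(le_trans hu).
lra.
Qed.

(* Cauchy's estimate for [1/q], with a non-optimal constant. *)
Lemma deriv_bound0 q (t : R) : 0 < t ->
  (forall x, nc x <= t -> 1 <= nc q.[x]) ->
  t * nc q^`().[0] <= 6 * nc q.[0] ^+ 2.
Proof.
move=> t0 hq.
have q0ge1 : 1 <= nc q.[0] by apply: hq; rewrite nc0 ltW.
have qn0 : q != 0.
  by apply: contraTneq q0ge1 => ->; rewrite horner0 nc0 ler10.
have [s Dq] := closed_field_poly_normal q.
set c := lead_coef q in Dq.
have c0 : c != 0 by rewrite lead_coef_eq0.
have qE x : q.[x] = c * \prod_(b <- s) (x - b).
  by rewrite Dq hornerZ horner_prod; under eq_bigr => b _ do rewrite hornerXsubC.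
have hs : all (fun b => t < nc b) s.
  apply/allP => b bs; rewrite ltNge; apply/negP => /hq.
  have -> : q.[b] = 0.
    by rewrite qE (big_rem b) //= subrr mul0r mulr0.
  by rewrite nc0 ler10.
have h12 : 0 < (2^-1 : R) by rewrite invr_gt0.
have [g hg] := approx_inv_prod (ltW t0) h12 hs.
have [q1 Dq1] : exists q1, q - q.[0]%:P = q1 * ('X - 0%:P).
  by apply/factor_theorem; rewrite rootE hornerD hornerN hornerC subrr eqxx.
have q1E x : q1.[x] * x = q.[x] - q.[0].
  by have := congr1 (horner^~ x) Dq1; rewrite !hornerE subr0 => ->.
have dq : q^`().[0] = q1.[0].
  have := congr1 (fun p => p^`().[0]) Dq1.
  rewrite derivB derivC subr0 => ->; rewrite derivM derivXsubC mulr1.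
  by rewrite hornerD hornerM hornerXsubC subrr mulr0 add0r.
(* With q = q(0) + x q1, [H] approximates q1/q, hence q'(0)/q(0) at the centre. On the circle |q1/q|
   is at most (1 + |q(0)|)/t, thus at most 2 |q(0)|/t. The approximation costs a factor 3/2 there
   and 1/2 at the centre, whence the constant 6. *)
pose H := c^-1 *: (q1 * g).
have HE x : H.[x] * q.[x] = q1.[x] * (g.[x] * \prod_(b <- s) (x - b)).
  by rewrite /H hornerZ hornerM qE; field.
have HB x : nc x = t -> nc H.[x] <= 3 * nc q.[0] / t.
  move=> hx; have hq1 := hq x; rewrite hx lexx in hq1; have {}hq1 := hq1 isT.
  have hW : nc (g.[x] * \prod_(b <- s) (x - b)) <= 3 / 2.
    have := hg x; rewrite hx lexx => /(_ isT) h.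
    have := nc_dist (g.[x] * \prod_(b <- s) (x - b)) 1; rewrite nc1; lra.
  have := congr1 nc (HE x); rewrite ncM [RHS]ncM.
  have := congr1 nc (q1E x); rewrite ncM hx.
  have := ncB q.[x] q.[0].
  move: hW q0ge1 hq1 (nc_ge0 q1.[x]) (nc_ge0 H.[x]).
  set A := nc q1.[x]; set W := nc (_ * _); set Q := nc q.[x]; set Q0 := nc q.[0].
  set Hn := nc H.[x]; set D := nc (_ - _).
  move=> W32 Q01 Q1 A0 Hn0 hD hA hH.
  rewrite ler_pdivlMr // -(@ler_pM2r _ Q) ?(lt_le_trans ltr01) //.
  have -> : Hn * t * Q = D * W by rewrite mulrAC hH -hA; ring.
  have : D * W <= D * (3 / 2) by rewrite ler_wpM2l // nc_ge0.
  have : 0 <= (Q0 - 1) * Q by rewrite mulr_ge0 // ?subr_ge0 // (le_trans ler01).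
  have : 0 <= (Q - 1) * Q0 by rewrite mulr_ge0 // ?subr_ge0 // (le_trans ler01).
  nra.
have := poly_center_bound (ltW t0) HB.
have := congr1 nc (HE 0); rewrite ncM [RHS]ncM -dq.
have hW : 1 / 2 <= nc (g.[0] * \prod_(b <- s) (0 - b)).
  have := hg 0; rewrite nc0 (ltW t0) => /(_ isT) h.
  have := nc_dist 1 (g.[0] * \prod_(b <- s) (0 - b)).
  rewrite nc1 nc_distC; lra.
move: hW (nc_ge0 q^`().[0]).
set W := nc (_ * _); set D := nc _^`().[0]; set Q0 := nc q.[0]; set Hn := nc H.[0].
move=> hW D0 e1; rewrite ler_pdivlMr // => h.
have : D * (1 / 2) <= D * W by rewrite ler_wpM2l.
have : Hn * t * Q0 <= 3 * Q0 * Q0 by rewrite ler_wpM2r // nc_ge0.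
rewrite -e1 => h1 h2.
have : t * (D * (1 / 2)) <= t * (Hn * Q0) by rewrite ler_pM2l.
lra.
Qed.

Lemma deriv_bound q (z : C) (t : R) : 0 < t ->
  (forall x, nc (x - z) <= t -> 1 <= nc q.[x]) ->
  t * nc q^`().[z] <= 6 * nc q.[z] ^+ 2.
Proof.
move=> t0 hq; pose p := q \Po ('X + z%:P).
have pE x : p.[x] = q.[x + z] by rewrite horner_comp !hornerE.
have := @deriv_bound0 p t t0.
rewrite deriv_comp hornerM horner_comp derivD derivX derivC !hornerE pE add0r.
by apply=> x hx; rewrite pE hq // addrK.
Qed.

End CauchyEstimate.

(** * Polynomials with real critical points contract towards the real line *)

Section RealCriticalPoints.
Variable R : realType.
Local Notation C := R[i].
Implicit Types (p q G : {poly C}) (x y z : C).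

(** On real arguments this is the imaginary part of [p]; as a real polynomial it is subject to the
    real mean value theorem. *)
Definition Im_poly p : {poly R} := \poly_(k < size p) complex.Im p`_k.

Lemma coef_Im_poly p k : (Im_poly p)`_k = complex.Im p`_k.
Proof. by rewrite coef_poly; case: ltnP => // h; rewrite nth_default. Qed.

Lemma ImD x y : complex.Im (x + y) = complex.Im x + complex.Im y.
Proof. by case: x y => [? ?] [? ?]. Qed.

Lemma ImMr x (a : R) : complex.Im (x * a%:C%C) = complex.Im x * a.
Proof. by case: x => [u v] /=; rewrite mulr0 add0r. Qed.

Lemma ImMn x n : complex.Im (x *+ n) = complex.Im x *+ n.
Proof. by elim: n => [|n IHn]; rewrite ?mulr0n // !mulrS ImD IHn. Qed.

Lemma horner_Im_poly p (a : R) : (Im_poly p).[a] = complex.Im p.[a%:C%C].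
Proof.
rewrite horner_poly horner_coef.
rewrite (big_morph (@complex.Im R) ImD (erefl : complex.Im 0 = 0)).
by apply: eq_bigr => k _; rewrite -rmorphXn ImMr.
Qed.

Lemma deriv_Im_poly p : (Im_poly p)^`() = Im_poly p^`().
Proof. by apply/polyP => k; rewrite coef_deriv !coef_Im_poly coef_deriv ImMn. Qed.

(** The mean value theorem along the vertical line through [x], parametrised by [p] below. *)
Lemma Im_horner_lipschitz G (x a b B : R) :
  (forall t, `|t| <= Num.max `|a| `|b| -> nc G^`().[(x +i* t)%C] <= B) ->
  `|complex.Im G.[(x +i* b)%C] - complex.Im G.[(x +i* a)%C]| <= B * `|b - a|.
Proof.
wlog ab : a b / a <= b.
  move=> h hB; case: (leP a b) => [/h|/ltW/h]; first exact.
  by rewrite distrC [`|b - a|]distrC; apply => t; rewrite maxC; apply: hB.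
move=> hB; move: ab; rewrite le_eqVlt => /orP[/eqP->|ab].
  by rewrite !subrr normr0 mulr0.
pose p := G \Po (x%:C%C%:P + 'i%C *: 'X).
have arg t : x%:C%C + 'i%C * t%:C%C = (x +i* t)%C.
  by rewrite [RHS]complexE.
have pE t : p.[t%:C%C] = G.[(x +i* t)%C].
  by rewrite /p horner_comp hornerD hornerC hornerZ hornerX arg.
have [t tab] := poly_mvt (Im_poly p) ab.
rewrite deriv_Im_poly !horner_Im_poly !pE => ->.
rewrite normrM ler_pM2r ?normr_gt0 ?subr_eq0 ?gt_eqF //.
rewrite /p deriv_comp hornerM horner_comp derivD derivC derivZ derivX add0r.
rewrite hornerD hornerC !hornerZ hornerX hornerC mulr1 arg.
rewrite (le_trans (abs_Im_le_nc _)) // ncM nci mulr1 hB //.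
move: tab; rewrite in_itv /= => /andP[h1 h2].
have [t0|t0] := leP 0 t.
  rewrite le_max (ger0_norm t0) orbC (le_trans (ltW h2)) ?ler_norm //.
rewrite le_max (ltr0_norm t0); apply/orP; left.
by rewrite -[`|a|]normrN (le_trans _ (ler_norm (- a))) // lerN2 ltW.
Qed.

Lemma nc_sub_real_le (x b t u : R) : `|t| <= `|u| ->
  nc ((x +i* t)%C - b%:C%C) <= nc ((x +i* u)%C - b%:C%C).
Proof.
rewrite -[(x +i* t)%C - _]/((x - b) +i* (t - 0))%C -[(x +i* u)%C - _]/((x - b) +i* (u -
  0))%C !subr0.
move=> tu; rewrite -(@ler_pXn2r _ 2) ?nnegrE ?nc_ge0 // !nc_sqr /= lerD2l.
by rewrite -[t ^+ 2]real_normK ?num_real // -[u ^+ 2]real_normK ?num_real // lerXn2r ?nnegrE.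
Qed.

(* The factor [kap < 1] quantifies that [G] strictly expands the hyperbolic
   metric |dz| / |Im z| away from the real line. *)
Lemma Im_horner_contraction G (c : C) (b0 : R) (s : seq R) (e M : R) :
  (forall a : R, complex.Im G.[a%:C%C] = 0) ->
  G^`() = c *: \prod_(b <- b0 :: s) ('X - b%:C%C%:P) ->
  0 < e ->
  exists2 kap, 0 <= kap < 1 & forall z, e <= `|complex.Im z| -> nc z <= M ->
    `|complex.Im G.[z]| <= kap * `|complex.Im z| * nc G^`().[z].
Proof.
move=> Greal DG e0.
have Ncom z : nc G^`().[z] = nc c * (nc (z - b0%:C%C) * \prod_(b <- s) nc (z - b%:C%C)).
  rewrite DG hornerZ horner_prod big_cons !ncM hornerXsubC nc_prod.
  by under [in LHS]eq_bigr => b _ do rewrite hornerXsubC.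
have mono (x t u : R) : `|t| <= `|u| ->
    \prod_(b <- s) nc ((x +i* t)%C - b%:C%C) <= \prod_(b <- s) nc ((x +i* u)%C - b%:C%C).
  by move=> tu; apply: ler_prod => b _; rewrite nc_ge0 nc_sub_real_le.
(* [V] bounds the squared distance from z to [b0]; the summand [e ^+ 2] makes [V] positive and
   [e ^+ 2 / V <= 1]. *)
pose V := (M + `|b0|) ^+ 2 + e ^+ 2.
have V0 : 0 < V by rewrite ltr_wpDl ?sqr_ge0 ?exprn_gt0.
have eV : e ^+ 2 / V <= 1 by rewrite ler_pdivrMr // mul1r lerDr sqr_ge0.
have eV0 : 0 < e ^+ 2 / V by rewrite divr_gt0 ?exprn_gt0.
(* Lowering the height from y to at most y/2 removes at least 3/4 y^2 from the squared distance to
   [b0], so this distance shrinks by the factor [k1]; the distances to the other critical points do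
   not grow. *)
pose k1 := Num.sqrt (1 - 3 / 4 * (e ^+ 2 / V)).
have k10 : 0 <= k1 by rewrite sqrtr_ge0.
have k1sq : k1 ^+ 2 = 1 - 3 / 4 * (e ^+ 2 / V).
  by rewrite sqr_sqrtr //; lra.
have k11 : k1 < 1.
  rewrite -(@ltr_pXn2r _ 2) ?nnegrE ?ler01 // k1sq expr1n; lra.
(* The average of the factor 1 on the upper half of the vertical segment and [k1] on the lower
   half. *)
exists ((1 + k1) / 2); first by apply/andP; split; lra.
case=> x y; rewrite [complex.Im (x +i* y)%C](_ : _ = y) // => ey zM; set D := nc _^`().[_].
have D0 : 0 <= D by exact: nc_ge0.
have b1 : `|complex.Im G.[(x +i* y)%C] - complex.Im G.[(x +i* (y / 2))%C]|
    <= D * `|y - y / 2|.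
  apply: Im_horner_lipschitz => t.
  have -> : Num.max `|y / 2| `|y| = `|y|.
    by rewrite normrM [`|2^-1|]ger0_norm ?invr_ge0 //; apply/max_idPr; have := normr_ge0 y; lra.
  move=> ty; rewrite /D !Ncom ler_wpM2l ?nc_ge0 // ler_pM ?nc_ge0 ?prodr_ge0 ?mono //.
    by move=> b _; rewrite nc_ge0.
  exact: nc_sub_real_le.
have b2 : `|complex.Im G.[(x +i* (y / 2))%C] - complex.Im G.[(x +i* 0)%C]|
    <= k1 * D * `|y / 2 - 0|.
  apply: Im_horner_lipschitz => t.
  rewrite normr0 [`|y / 2|]normrM [`|2^-1|]ger0_norm ?invr_ge0 // (max_idPr _) ?mulr_ge0
    ?invr_ge0 //.
  move=> ty; rewrite /D !Ncom [leRHS]mulrCA ler_wpM2l ?nc_ge0 // [leRHS]mulrA ler_pM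
    ?nc_ge0 ?prodr_ge0 ?mono //.
  - by move=> b _; rewrite nc_ge0.
  - rewrite -(@ler_pXn2r _ 2) ?nnegrE ?mulr_ge0 ?nc_ge0 // exprMn k1sq !nc_sqr /=.
    have hA : (x - b0) ^+ 2 + y ^+ 2 <= V.
      have : nc ((x +i* y)%C - b0%:C%C) <= M + `|b0|.
        by rewrite (le_trans (ncB _ _)) // nc_real lerD2r.
      have Mb : 0 <= M + `|b0| by rewrite addr_ge0 // (le_trans (nc_ge0 _) zM).
      rewrite -(@ler_pXn2r _ 2) ?nnegrE ?nc_ge0 // nc_sqr /= subr0 => h.
      by rewrite (le_trans h) // lerDl sqr_ge0.
    have he : e ^+ 2 <= y ^+ 2.
      by rewrite -[y ^+ 2]real_normK ?num_real // lerXn2r ?nnegrE // ltW.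
    have ht : t ^+ 2 <= y ^+ 2 / 4.
      rewrite -[t ^+ 2]real_normK ?num_real // -[y ^+ 2]real_normK ?num_real //.
      have -> : `|y| ^+ 2 / 4 = (`|y| / 2) ^+ 2 by field.
      by rewrite lerXn2r ?nnegrE // mulr_ge0 // invr_ge0.
    rewrite !subr0.
    have : e ^+ 2 / V * ((x - b0) ^+ 2 + y ^+ 2) <= e ^+ 2.
      by rewrite mulrAC ler_pdivrMr // ler_pM2l // exprn_gt0.
    lra.
  by rewrite (le_trans ty) // ler_pdivrMr // ler_peMr // ler1n.
move: b1 b2; rewrite complexr0 Greal !subr0.
have -> : y - y / 2 = y / 2 by field.
rewrite normrM [`|2^-1|]ger0_norm ?invr_ge0 //.
set I1 := complex.Im _; set I2 := complex.Im _ => b1 b2.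
have := ler_normD (I1 - I2) I2; rewrite subrK => h.
have -> : (1 + k1) / 2 * `|y| * D = D * (`|y| / 2) + k1 * D * (`|y| / 2) by field.
lra.
Qed.

(* Gauss--Lucas on the real line. *)
Lemma deriv_real_rooted (s : seq R) : (2 <= size s)%N ->
  exists c b0 s', (\prod_(a <- s) ('X - a%:C%C%:P) : {poly C})^`()
     = c *: \prod_(b <- b0 :: s') ('X - b%:C%C%:P).
Proof.
move=> s2; set F := \prod_(a <- s) _.
have [r Dr] := closed_field_poly_normal F^`().
(* The logarithmic derivative is the sum of the 1/(z - a), whose imaginary parts all have the sign
   opposite to that of Im z, so it cannot vanish off the real line. *)
have logd (z : C) : complex.Im z != 0 ->
    F.[z] != 0 /\ exists2 w, F^`().[z] = F.[z] * w & complex.Im w * complex.Im z < 0.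
  move=> Iz; rewrite /F; case: s s2 {F Dr} => // a s _; move: s.
  have F0 s : (\prod_(a <- s) ('X - a%:C%C%:P)).[z] != 0.
    rewrite horner_prod prodf_seq_neq0; apply/allP => b _.
    rewrite hornerXsubC subr_eq0; apply: contraNneq Iz => ->.
    by rewrite /= eqxx.
  move=> s; split=> //.
  have Iv b : complex.Im (z - b%:C%C)^-1 * complex.Im z < 0.
    move: Iz; case: z {F0} => x y /= Iz; rewrite subr0 mulNr oppr_lt0 mulrAC.
    by rewrite divr_gt0 // -?expr2 ?ltr_wpDl ?sqr_ge0 // lt_def sqr_ge0 andbT sqrf_eq0.
  have zb b : z - b%:C%C != 0.
    by have := F0 [:: b]; rewrite big_seq1 hornerXsubC.
  have step b s0 w : (\prod_(a <- s0) ('X - a%:C%C%:P))^`().[z] = (\prod_(a <- s0) ('X -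
    a%:C%C%:P)).[z] * w ->
      (\prod_(a <- b :: s0) ('X - a%:C%C%:P))^`().[z] = (\prod_(a <- b :: s0) ('X -
        a%:C%C%:P)).[z] * ((z - b%:C%C)^-1 + w).
    move=> h; rewrite big_cons derivM derivXsubC mul1r hornerD !hornerM h hornerXsubC.
    by field; exact: zb.
  elim: s a => [|b s IHs] a.
    exists ((z - a%:C%C)^-1 + 0); last by rewrite addr0.
    by apply: step; rewrite big_nil derivC hornerC mulr0.
  have [w hw wI] := IHs b; exists ((z - a%:C%C)^-1 + w); first exact: step.
  by rewrite ImD mulrDl -[0]addr0 ltrD.
have Rr : all (fun z => complex.Im z == 0) r.
  apply/allP => z zr; apply: contraT => /logd [F0 [w hw wI]].
  have F'0 : F^`().[z] = 0.
    rewrite Dr hornerZ horner_prod (big_rem z) //= hornerXsubC subrr mul0r mulr0 //.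
  move: hw; rewrite F'0 => /esym/eqP; rewrite mulf_eq0 (negbTE F0) /= => /eqP w0.
  by move: wI; rewrite w0 mul0r ltxx.
have Er : r = [seq a%:C%C | a <- [seq complex.Re z | z <- r]].
  rewrite -map_comp -[LHS]map_id; apply/eq_in_map => z /(allP Rr) /eqP.
  by case: z => x y /= ->.
case: r Dr Rr Er => [|z0 r] Dr Rr Er.
  (* Without roots the derivative would be constant, but its coefficient of degree [(size s).-1 > 0]
     is [size s]. *)
  have sF : size F = (size s).+1 by rewrite size_prod_XsubC.
  have := congr1 (fun p : {poly C} => p`_(size s).-1) Dr.
  have Fm : lead_coef F = 1 by apply/monicP; apply: monic_prod_XsubC.
  rewrite big_nil alg_polyC coefC coef_deriv prednK ?(ltn_trans _ s2) //.
  move: Fm; rewrite lead_coefE sF /= => ->.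
  rewrite (_ : ((size s).-1 == 0)%N = false); last by case: (size s) s2 => [|[]].
  by move/eqP; rewrite pnatr_eq0; case: (size s) s2.
exists (lead_coef F^`()), (complex.Re z0), [seq complex.Re z | z <- r].
by rewrite {1}Dr Er big_map.
Qed.

End RealCriticalPoints.

(** * Iterates of polynomials and bounded orbits *)

Section BoundedOrbits.
Variable R : realType.
Local Notation C := R[i].
Implicit Types (p q G : {poly C}) (x y z : C).

Lemma horner_local_lipschitz p z : exists2 L, 0 <= L &
  forall t, nc (t - z) <= 1 -> nc (p.[t] - p.[z]) <= L * nc (t - z).
Proof.
elim/poly_ind: p => [|p c [L L0 hL]].
  by exists 0 => // t _; rewrite !horner0 subrr nc0 mul0r.
exists (L * (nc z + 1) + nc p.[z]); first by rewrite addr_ge0 ?mulr_ge0 ?addr_ge0 ?nc_ge0.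
move=> t t1; rewrite !hornerMXaddC.
have -> : p.[t] * t + c - (p.[z] * z + c) = (p.[t] - p.[z]) * t + p.[z] * (t - z) by ring.
rewrite (le_trans (ncD _ _)) // !ncM mulrDl lerD2r mulrAC ler_pM ?nc_ge0 ?hL //.
by rewrite {1}(_ : t = z + (t - z)) ?(le_trans (ncD _ _)) ?lerD2l //; ring.
Qed.

Lemma horner_continuous_at p z e : 0 < e -> exists2 d, 0 < d &
  forall t, nc (t - z) <= d -> nc (p.[t] - p.[z]) <= e.
Proof.
move=> e0; have [L L0 hL] := horner_local_lipschitz p z.
have L1 : 0 < L + 1 by rewrite ltr_wpDl.
exists (Num.min 1 (e / (L + 1))); first by rewrite lt_min ltr01 divr_gt0.
move=> t; rewrite le_min => /andP[t1 te].
rewrite (le_trans (hL _ t1)) //.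
move: te; rewrite ler_pdivlMr // mulrC mulrDl mul1r; apply: le_trans.
by rewrite lerDl nc_ge0.
Qed.

Definition iter_poly G n : {poly C} := iter n (fun Q => G \Po Q) 'X.

Lemma horner_iter_poly G n z : (iter_poly G n).[z] = iter n (horner G) z.
Proof. by elim: n => [|n IHn]; rewrite ?hornerX //= horner_comp IHn. Qed.

Lemma deriv_iter_poly G n z :
  (iter_poly G n.+1)^`().[z] = G^`().[iter n (horner G) z] * (iter_poly G n)^`().[z].
Proof. by rewrite /= deriv_comp hornerM horner_comp horner_iter_poly. Qed.

(** Compactness of the segment turns the pointwise radii into one uniform height. *)
Lemma strip_of_segment (P : C -> Prop) (a b : R) :
  (forall x : R, a <= x <= b -> exists2 d, 0 < d & forall t, nc (t - x%:C%C) < d -> P t) ->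
  exists2 e, 0 < e & forall t, a <= complex.Re t <= b -> `|complex.Im t| < e -> P t.
Proof.
move=> h.
pose Q (e x : R) := forall t, complex.Re t = x -> `|complex.Im t| < e -> P t.
have /compact_near_coveringP K := @segment_compact R a b.
have : \forall e \near 0^'+, `[a, b] `<=` Q e.
  apply: K => x; rewrite /= in_itv /= => /h [d d0 hd].
  have d2 : 0 < d / 2 by rewrite divr_gt0.
  exists (ball x (d / 2), [set e | e < d / 2]); first split.
  - exact: nbhsx_ballx.
  - exact: nbhs_right_lt.
  case=> x' e /= [xx' ed] [u v] /= ux' ve; apply: hd.
  rewrite (_ : (u +i* v)%C - x%:C%C = (u - x)%:C%C + 'i%C * v%:C%C); last first.
    by simpc; rewrite /= ?mul0r ?subr0 ?addr0 ?add0r.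
  rewrite (le_lt_trans (ncD _ _)) // ncM nci mul1r !nc_real ux' distrC.
  move: xx'; rewrite /ball /= => xx'; lra.
move=> hQ; have [e [he e0]] := @filter_ex _ _ (at_right_proper_filter 0) _ (filterI hQ
  (nbhs_right_gt 0)).
exists e => // t hab; have /(_ (complex.Re t)) := he.
by rewrite /= in_itv /= => /(_ hab); apply.
Qed.

(** * Bounded orbits relative to an abstract closed, backward invariant set *)

Section Core.
Variables (G : {poly C}) (S : set C) (c : C) (b0 : R) (s : seq R).
Hypothesis Greal : forall a : R, complex.Im G.[a%:C%C] = 0.
Hypothesis DG : G^`() = c *: \prod_(b <- b0 :: s) ('X - b%:C%C%:P).
Hypothesis Spreim : forall z, S G.[z] -> S z.
Hypothesis Sdisc : forall z, nc z < 1 -> S z.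
Hypothesis Sclosed : forall z, ~ S z ->
  exists2 r, 0 < r & forall t, nc (t - z) <= r -> ~ S t.
Hypothesis Sreal : forall a : R, `|a| < 4 ->
  exists2 r, 0 < r & forall t, nc (t - a%:C%C) < r -> S t.
Hypothesis Gescape : forall z, 6 < nc z -> 2 * nc z <= nc G.[z].
Hypothesis Gbig : forall a : R, 4 <= `|a| -> 6 < nc G.[a%:C%C].

Lemma escape z : 6 < nc z -> forall n, 6 * 2 ^+ n <= nc (iter n (horner G) z).
Proof.
move=> z6; have H n : 6 < nc (iter n (horner G) z) /\ 6 * 2 ^+ n <= nc (iter n (horner G) z).
  elim: n => [|n [h1 h2]]; first by rewrite expr0 mulr1 ltW.
  have := Gescape h1; rewrite iterS exprS; lra.
by move=> n; have [] := H n.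
Qed.

Lemma exists_expr2_gt (M : R) : exists n, M < 6 * 2 ^+ n.
Proof.
have [n hn] : exists n, (2^-1) ^+ n <= (`|M| + 1)^-1.
  apply: exists_expr_lt; first by rewrite invr_ge0 ler0n invf_lt1 ?ltr1n.
  by rewrite invr_gt0 ltr_wpDl.
exists n; move: hn; rewrite exprVn lef_pV2 ?posrE ?exprn_gt0 ?ltr_wpDl //.
have := ler_norm M; have : 0 < (2 : R) ^+ n by rewrite exprn_gt0.
lra.
Qed.

Lemma bounded_orbit_le6 z M : (forall n, nc (iter n (horner G) z) <= M) ->
  forall n, nc (iter n (horner G) z) <= 6.
Proof.
move=> hM n; rewrite leNgt; apply/negP => /escape h.
have [k hk] := exists_expr2_gt M.
by have := lt_le_trans hk (h k); rewrite -iterD ltNge hM.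
Qed.

(* Outside the closed set [S] a bounded orbit stays away from the real line, so
   the derivatives of the iterates blow up there; but they are controlled by
   Cauchy's estimate for the inverses of the iterates, which avoid the unit
   disc on a neighbourhood of the starting point. *)
Theorem bounded_orbit_in z M : (forall n, nc (iter n (horner G) z) <= M) -> S z.
Proof.
move=> /bounded_orbit_le6 hM; apply: contrapT => nSz.
have nS t n : ~ S t -> ~ S (iter n (horner G) t).
  by move=> nSt; elim: n => //= n IHn /Spreim.
(* Near a real point of modulus below 4 lies only [S]; near the other real points one application of
   [G] leads beyond radius 6. Neither can happen along the orbit. *)
pose P t := S t \/ 6 < nc G.[t].
have [e e0 he] : exists2 e, 0 < e & forall t, - 6 <= complex.Re t <= 6 ->
    `|complex.Im t| < e -> P t.
  apply: strip_of_segment => x _; have [x4|x4] := ltP `|x| 4.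
    by have [r r0 hr] := Sreal x4; exists r => // t /hr; left.
  have x6 := Gbig x4.
  have e0 : 0 < (nc G.[x%:C%C] - 6) / 2 by rewrite divr_gt0 ?subr_gt0.
  have [d d0 hd] := horner_continuous_at G x%:C%C e0.
  exists d => // t /ltW /hd h; right.
  by have := nc_dist G.[x%:C%C] G.[t]; rewrite nc_distC; lra.
have Ime n : e <= `|complex.Im (iter n (horner G) z)|.
  rewrite leNgt; apply/negP => /he; case.
  - have := abs_Re_le_nc (iter n (horner G) z).
    by rewrite ler_norml => /andP[h1 h2]; have := hM n; apply/implyP; lra.
  - exact: nS.
  by rewrite ltNge -iterS hM.
have [k /andP[k0 k1] hk] := @Im_horner_contraction _ G c b0 s e 6 Greal DG e0.
have [r r0 hr] := Sclosed nSz.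
pose D n := nc (iter_poly G n)^`().[z].
(* The contraction is chained along the orbit by the chain rule. Since the left side is at least
   [e], the derivative [D n] must grow at least like k^(-n). *)
have hD n : `|complex.Im (iter n (horner G) z)| <= k ^+ n * `|complex.Im z| * D n.
  elim: n => [|n IHn]; first by rewrite /D /= derivX hornerC nc1 expr0 mul1r mulr1.
  rewrite iterS (le_trans (hk _ (Ime n) (hM n))) // /D deriv_iter_poly ncM -/(D n).
  rewrite exprS.
  set x := nc G^`().[_]; set a := `|_| in IHn *.
  have -> : k * k ^+ n * `|complex.Im z| * (x * D n)
    = k * (k ^+ n * `|complex.Im z| * D n) * x by ring.
  by rewrite ler_wpM2r ?nc_ge0 // ler_wpM2l.
(* The disc of radius [r] about z misses [S], and so do its iterates, whose moduli are therefore at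
   least 1; at the centre they are at most 6. *)
have rD n : r * D n <= 216.
  rewrite (le_trans (deriv_bound r0 _)) //.
    move=> x /hr nSx; have := nS x n nSx => h; rewrite horner_iter_poly leNgt.
    by apply/negP => /Sdisc.
  have -> : 216 = 6 * 6 ^+ 2 :> R by ring.
  by rewrite ler_pM2l // horner_iter_poly lerXn2r ?nnegrE ?nc_ge0.
pose B := 216 * (`|complex.Im z| + 1).
have B0 : 0 < B by rewrite mulr_gt0 // ltr_wpDl.
(* [n] will be chosen with k^n B at most half of [e * r], against the lower bound [e * r] for the
   same quantity. *)
have er : 0 < e * r / (2 * B) by rewrite divr_gt0 ?mulr_gt0.
have [n hn] := exists_expr_lt (introT andP (conj k0 k1)) er.
have : e * r <= k ^+ n * B.
  have : e * r <= k ^+ n * `|complex.Im z| * D n * r.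
    by rewrite ler_pM2r // (le_trans (Ime n)).
  move/le_trans; apply; rewrite -!mulrA ler_wpM2l ?exprn_ge0 //.
  rewrite /B [leRHS]mulrC ler_pM ?lerDl //.
    by rewrite mulr_ge0 ?nc_ge0 ?(ltW r0).
  by rewrite mulrC; exact: rD.
move: hn; rewrite ler_pdivlMr ?mulr_gt0 // mulrCA => hn h.
have : 0 < e * r by rewrite mulr_gt0.
lra.
Qed.

End Core.
End BoundedOrbits.

(** * Tridiagonal determinants and the formula for [P_poly] and [Pstar_poly] *)

Section Continuants.
Variable R : realType.
Local Notation C := R[i].
Implicit Types (k : int -> int) (i : int) (x z : C).

(* [continuant s n.+1] is the determinant of order [n] with ['X] on the
   diagonal, 1 above it and [s] below it; [continuant 1 n.+1] is U_n(X/2). *)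
Fixpoint continuant (s : int) n : {poly C} :=
  if n is n1.+1 then
    if n1 is n2.+1 then 'X * continuant s n1 - s%:~R * continuant s n2 else 1
  else 0.

Lemma continuantSS s n :
  continuant s n.+2 = 'X * continuant s n.+1 - s%:~R * continuant s n.
Proof. by []. Qed.

Lemma horner_int (s : int) (x : C) : (s%:~R : {poly C}).[x] = s%:~R.
Proof. by rewrite -(rmorph_int (@polyC C)) hornerC. Qed.

(** Expansion along the first row, then of the second minor along its first column. *)
Lemma det_tridiag_rec k i n :
  \det (tridiag_mx R k i n.+2) =
  'X * \det (tridiag_mx R k (i + 1) n.+1) - (k i)%:~R * \det (tridiag_mx R k (i + 2) n).
Proof.
rewrite (expand_det_row _ ord0) !big_ord_recl big1 ?addr0; last first.
  by move=> j _; rewrite mxE /= mul0r.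
rewrite /cofactor !mxE /= expr0 !mul1r expr1 mulN1r; congr (_ + - _).
  congr ('X * \det _); apply/matrixP => r s; rewrite !mxE.
  rewrite (inj_eq (@lift_inj _ _)) /= /bump /= !add1n !eqSS.
  by rewrite (_ : i + 1 + s%:Z = i + (s.+1)%:Z) // intS addrA.
rewrite (expand_det_col _ ord0) big_ord_recl big1 ?addr0; last first.
  by move=> r _; rewrite !mxE /= mul0r.
rewrite /cofactor !mxE /= addr0 expr0 mul1r; congr (_ * \det _).
apply/matrixP => r s; rewrite !mxE /= /bump /= !add1n.
rewrite -val_eqE /= !eqSS (_ : i + 2 + s%:Z = i + (s.+2)%:Z) //.
by lia.
Qed.

Lemma det_tridiag_const k i s n : (forall t, (t.+1 < n)%N -> k (i + t%:Z) = s) ->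
  \det (tridiag_mx R k i n) = continuant s n.+1.
Proof.
have [N] := ubnP n; elim: N n i => // N IHN [|[|n]] i nN hk.
- by rewrite det_mx00.
- by rewrite det_mx11 mxE /= mulr0 mulr1 subr0.
rewrite det_tridiag_rec continuantSS -(addr0 i) hk // addr0.
rewrite !IHN //; try lia.
  by move=> t ht; rewrite -addrA -[2 + _]/(t.+2)%:Z hk.
by move=> t ht; rewrite -addrA -[1 + _]/(t.+1)%:Z hk.
Qed.

(** The recursion from the top is that of the constant case; only the last subdiagonal entry -1
    changes a sign, and it enters through the base cases. *)
Lemma det_tridiag_flip k i s n : k (i + n%:Z) = -1 ->
    (forall t, (t < n)%N -> k (i + t%:Z) = s) ->
  \det (tridiag_mx R k i n.+2) = 'X * continuant s n.+2 + continuant s n.+1.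
Proof.
have [N] := ubnP n; elim: N n i => // N IHN [|[|n]] i nN hn hk.
- rewrite det_tridiag_rec -[i in k i]addr0 hn det_mx00 det_mx11 mxE /=.
  by rewrite mulrN1z; ring.
- rewrite det_tridiag_rec IHN //; last by rewrite addr0.
  rewrite -[i in k i]addr0 hk // det_mx11 mxE /=; ring.
rewrite det_tridiag_rec -[i in k i]addr0 hk // !IHN //; try lia.
- by rewrite !continuantSS; ring.
- by rewrite -addrA -[2 + _]/(n.+2)%:Z.
- by move=> t ht; rewrite -addrA -[2 + _]/(t.+2)%:Z hk.
- by rewrite -addrA -[1 + _]/(n.+2)%:Z.
by move=> t ht; rewrite -addrA -[1 + _]/(t.+1)%:Z hk.
Qed.

(** The conventions for i - j = 1 and i - j = 2 agree with the determinants of order 1 and 0, while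
    i - j = 3 would give order -1. *)
Lemma q_poly_det k i j n : j - i + 2 = n%:Z -> q_poly R k i j = \det (tridiag_mx R k i n).
Proof.
move=> e; rewrite /q_poly e /=.
case: eqP => [h|_].
  have -> : n = 1%N by lia.
  by rewrite det_mx11 mxE.
case: eqP => [h|_].
  have -> : n = 0%N by lia.
  by rewrite det_mx00.
by case: eqP => // h; exfalso; lia.
Qed.

Lemma continuant_opp s n x :
  (continuant s n.+1).[- x] = (-1) ^+ n * (continuant s n.+1).[x].
Proof.
have [N] := ubnP n; elim: N n => // N IHN [|[|n]] nN.
- by rewrite !hornerC mul1r.
- by rewrite /= !hornerE; ring.
rewrite !(continuantSS _ n.+1) !hornerD !hornerN !hornerM !IHN; try lia.
by rewrite !hornerX !horner_int !exprS; ring.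
Qed.

(** The entry -1 at place m - 1 adds a smaller continuant to the first determinant, and the second
    determinant cancels exactly that term; parity absorbs the signs from the argument -x. *)
Lemma horner_p_poly_P_vec s m x : (2 <= m)%N ->
  (p_poly R m (P_vec s m)).[x] = x * (continuant s m).[x].
Proof.
case: m => [|[|n]] // _; rewrite /p_poly.
rewrite (@q_poly_det _ _ _ n.+2); last by lia.
rewrite (@q_poly_det _ _ _ n); last by lia.
rewrite (@det_tridiag_flip _ _ s); first last.
- by move=> t ht; rewrite /P_vec; case: eqP => [|_]; [lia|]; case: eqP => //; lia.
- by rewrite /P_vec; case: eqP => //; lia.
rewrite (@det_tridiag_const _ _ s); last first.
  by move=> t ht; rewrite /P_vec; case: eqP => [|_]; [lia|]; case: eqP => //; lia.
have -> : P_vec s n.+2 n.+2%:Z = 1.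
  by rewrite /P_vec; case: eqP => [|_]; [lia|]; rewrite eqxx.
rewrite mul1r hornerM horner_exp hornerN hornerC hornerD hornerN !horner_comp.
rewrite hornerN hornerX hornerD hornerM hornerX addrK continuant_opp.
rewrite -[n.+2]/(n.+1.+1) exprS mulN1r mulrA mulrNN.
by rewrite mulrACA -exprD addnn -mul2n exprM sqrrN !expr1n !mul1r.
Qed.

Lemma continuant_rotate n x :
  'i%C ^+ n * (continuant (-1) n.+1).[x] = (continuant 1 n.+1).['i%C * x].
Proof.
have [N] := ubnP n; elim: N n => // N IHN [|[|n]] nN.
- by rewrite !hornerC mul1r.
- by rewrite /= !hornerE; ring.
have i2 : 'i%C * 'i%C = -1 :> C by rewrite -expr2 sqr_i.
rewrite !(continuantSS _ n.+1) !hornerD !hornerN !hornerM -!IHN; try lia.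
rewrite !hornerX !horner_int !exprS.
transitivity ('i%C * x * ('i%C * 'i%C ^+ n * (continuant (-1) n.+2).[x])
  + ('i%C * 'i%C) * 'i%C ^+ n * (continuant (-1) n.+1).[x]); first by ring.
by rewrite i2; ring.
Qed.

End Continuants.

(** * Roots, growth and trigonometric form of the Chebyshev polynomials *)

Section ChebyshevRoots.
Variable R : realType.
Local Notation C := R[i].
Implicit Types (x z : C) (a b : R).

Local Notation U n := (continuant R 1 n).

Lemma continuantSS1 n : U n.+2 = 'X * U n.+1 - U n.
Proof. by rewrite continuantSS mulr1z mul1r. Qed.

Lemma horner_continuantSS n x : (U n.+2).[x] = x * (U n.+1).[x] - (U n).[x].
Proof. by rewrite continuantSS1 hornerD hornerN hornerM hornerX. Qed.

(* Christoffel--Darboux. *)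
Lemma Im_continuant n x : exists2 T, 1 <= T &
  complex.Im ((U n.+2).[x] * ((U n.+1).[x])^*%C) = complex.Im x * T.
Proof.
elim: n => [|n [T T1 IHn]].
  exists 1 => //; rewrite horner_continuantSS !hornerC.
  by case: x => u v; simpc; rewrite /=; simpc; rewrite /=; ring.
exists (T + nc (U n.+2).[x] ^+ 2); first by rewrite (le_trans T1) // lerDl sqr_ge0.
rewrite mulrDr -IHn nc_sqr [in LHS]horner_continuantSS.
case: (U n.+2).[x] => a b; case: (U n.+1).[x] => c d; case: x {IHn} => u v.
by simpc; rewrite /=; ring.
Qed.

Lemma root_continuant_real n x : root (U n.+2) x -> complex.Im x = 0.
Proof.
move=> /rootP x0; have [T T1] := Im_continuant n x; rewrite x0 mul0r.
move/esym/eqP; rewrite mulf_eq0 => /orP[/eqP//|/eqP T0].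
by move: T1; rewrite T0 ler10.
Qed.

Lemma continuant_growth n x : 2 <= nc x -> nc (U n).[x] + 1 <= nc (U n.+1).[x].
Proof.
move=> x2; elim: n => [|n IHn]; first by rewrite !hornerC nc0 nc1 add0r.
rewrite horner_continuantSS.
have := nc_dist (x * (U n.+1).[x]) (U n).[x]; rewrite ncM.
have : 2 * nc (U n.+1).[x] <= nc x * nc (U n.+1).[x] by rewrite ler_wpM2r ?nc_ge0.
lra.
Qed.

Lemma continuant_monic n : U n.+1 \is monic /\ size (U n.+1) = n.+1.
Proof.
have [N] := ubnP n; elim: N n => // N IHN [|[|n]] nN.
- by rewrite monic1 size_poly1.
- by rewrite /= mulr1 mulr0 subr0 monicX size_polyX.
have [m1 s1] : U n.+2 \is monic /\ size (U n.+2) = n.+2 by apply: IHN; lia.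
have [m0 s0] : U n.+1 \is monic /\ size (U n.+1) = n.+1 by apply: IHN; lia.
have sX : size ('X * U n.+2) = n.+3 by rewrite mulrC size_mulX ?s1 // monic_neq0.
rewrite continuantSS1; split.
  rewrite monicE lead_coefDl ?sX ?size_polyN ?s0 //.
  by rewrite -monicE monicMl ?monicX.
by rewrite size_polyDl ?sX // size_polyN s0.
Qed.

Lemma continuant_at2 n : (U n).[2] = n%:R.
Proof.
have [N] := ubnP n; elim: N n => // N IHN [|[|n]] nN; rewrite ?hornerC //.
by rewrite horner_continuantSS !IHN; try lia; rewrite -[n.+2]addn2 -[n.+1]addn1 !natrD; ring.
Qed.

Lemma continuant_trig n (t : R) :
  (U n).[(2 * cos t)%:C%C] * (sin t)%:C%C = (sin (n%:R * t))%:C%C.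
Proof.
have [N] := ubnP n; elim: N n => // N IHN [|[|n]] nN.
- by rewrite hornerC !mul0r sin0.
- by rewrite hornerC !mul1r.
rewrite horner_continuantSS mulrBl -mulrA !IHN; try lia.
rewrite -rmorphM -rmorphB /=; congr (_%:C)%C.
have -> : n.+2%:R * t = n.+1%:R * t + t by rewrite -[n.+2]addn1 natrD; ring.
have -> : n%:R * t = n.+1%:R * t - t by rewrite -[n.+1]addn1 natrD; ring.
by rewrite sinB sinD; ring.
Qed.

(** Roots are real by the Christoffel--Darboux identity, and of modulus below 2 because the values
    have strictly increasing modulus in n where |x| is at least 2. *)
Lemma continuant_real_rooted n : exists2 r : seq R, size r = n.+1 &
  U n.+2 = \prod_(a <- r) ('X - a%:C%C%:P) /\ all (fun a => `|a| < 2) r.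
Proof.
have [r Dr] := closed_field_poly_normal (U n.+2).
have [mU sU] := continuant_monic n.+1.
move: Dr; rewrite (monicP mU) scale1r => Dr.
have rootr z : z \in r -> root (U n.+2) z by rewrite Dr root_prod_XsubC.
have Er : r = [seq a%:C%C | a <- [seq complex.Re z | z <- r]].
  rewrite -map_comp -[LHS]map_id; apply/eq_in_map => z /rootr /root_continuant_real.
  by case: z => x y /= ->.
exists [seq complex.Re z | z <- r].
  by have := sU; rewrite Dr size_prod_XsubC size_map => -[].
split; first by rewrite [LHS]Dr {1}Er !big_map.
apply/allP => a ha; rewrite ltNge; apply/negP => a2.
have /rootr /rootP : a%:C%C \in r by rewrite Er; apply: map_f.
move=> h; have := @continuant_growth n.+1 a%:C%C; rewrite nc_real => /(_ a2).
by rewrite h nc0; have := nc_ge0 (U n.+1).[a%:C%C]; lra.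
Qed.

End ChebyshevRoots.

(** * The map induced on s = x^2 *)

Section SquaredMap.
Variable R : realType.
Local Notation C := R[i].
Local Notation U n := (continuant R 1 n).
Variables (n : nat) (r : seq R) (sg : R).
Hypothesis size_r : size r = n.+1.
Hypothesis Ur : U n.+2 = \prod_(a <- r) ('X - a%:C%C%:P).
Hypothesis r2 : all (fun a => `|a| < 2) r.
Hypothesis sgE : `|sg| = 1.

(** Squaring semiconjugates x -> eta x U_m(x) to this map when eta^2 = [sg]; its roots are 0 and the
    squares of the roots of U_m, with m = n + 2. *)
Definition sq_map : {poly C} := sg%:C%C *: \prod_(a <- 0 :: r) ('X - (a ^+ 2)%:C%C%:P).

Lemma horner_sq_map z :
  sq_map.[z] = sg%:C%C * (z * \prod_(a <- r) (z - (a ^+ 2)%:C%C)).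
Proof.
rewrite hornerZ horner_prod big_cons hornerXsubC expr0n /= subr0; congr (_ * (_ * _)).
by apply: eq_bigr => a _; rewrite hornerXsubC.
Qed.

Lemma nc_sq_map z : nc sq_map.[z] = nc z * \prod_(a <- r) nc (z - (a ^+ 2)%:C%C).
Proof. by rewrite horner_sq_map !ncM nc_real sgE mul1r nc_prod. Qed.

Lemma continuant_sqr x : (U n.+2).[x] ^+ 2 = \prod_(a <- r) (x ^+ 2 - (a ^+ 2)%:C%C).
Proof.
(* By parity U(x)^2 is U(x) U(-x) up to sign, and the factors x - a and -x - a pair up to a^2 -
   x^2. *)
have h : (U n.+2).[x] ^+ 2 = (-1) ^+ n.+1 * ((U n.+2).[x] * (U n.+2).[- x]).
  have e1 : (-1) ^+ n.+1 * (-1) ^+ n.+1 = 1 :> C.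
    by rewrite -exprD addnn -mul2n exprM sqrrN !expr1n.
  rewrite continuant_opp -[LHS]mul1r -[in LHS]e1; move: (_ ^+ n.+1) => e.
  by move: (_.[x]) => u; ring.
rewrite h Ur !horner_prod -size_r -big_split /=.
elim: r => [|a s IHs] /=; first by rewrite !big_nil expr0 mulr1.
rewrite !big_cons -IHs !hornerXsubC exprS rmorphXn /=; ring.
Qed.

Lemma sq_map_sqr x : sq_map.[x ^+ 2] = sg%:C%C * (x * (U n.+2).[x]) ^+ 2.
Proof. by rewrite horner_sq_map exprMn continuant_sqr. Qed.

Lemma sq_map_real a : complex.Im sq_map.[a%:C%C] = 0.
Proof.
rewrite horner_sq_map.
under eq_bigr => b _ do rewrite -rmorphB.
by rewrite -rmorph_prod -!rmorphM.
Qed.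

Lemma deriv_sq_map : exists c b0 s,
  sq_map^`() = c *: \prod_(b <- b0 :: s) ('X - b%:C%C%:P).
Proof.
have [|c [b0 [s h]]] := @deriv_real_rooted R [seq a ^+ 2 | a <- 0 :: r].
  by rewrite size_map /= size_r.
exists (sg%:C%C * c), b0, s.
by rewrite /sq_map derivZ -scalerA -h big_map.
Qed.

Lemma prod_ge (s : seq R) (f : R -> R) (m : R) : 1 <= m ->
  (0 < size s)%N -> {in s, forall a, m <= f a} -> m <= \prod_(a <- s) f a.
Proof.
move=> m1; case: s => // a s _ h; rewrite big_cons.
rewrite -[m]mulr1 ler_pM ?h ?mem_head // ?(le_trans ler01) //.
rewrite big_seq; elim/big_ind: _ => // [u v u1 v1|b bs].
  by rewrite -[1]mulr1 ler_pM.
by rewrite (le_trans m1) // h // inE bs orbT.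
Qed.

Lemma sqr_lt4 a : a \in r -> a ^+ 2 < 4.
Proof.
move=> /(allP r2); rewrite ltr_norml => /andP[h1 h2]; nra.
Qed.

(** The numbers a^2 lie in [0, 4), so every factor z - a^2 has modulus above 2. *)
Lemma sq_map_escape z : 6 < nc z -> 2 * nc z <= nc sq_map.[z].
Proof.
move=> z6; rewrite nc_sq_map mulrC ler_wpM2l ?nc_ge0 // prod_ge ?size_r ?ler1n //.
move=> a /sqr_lt4 a4; have := nc_dist z (a ^+ 2)%:C%C.
by rewrite nc_real ger0_norm ?sqr_ge0 //; lra.
Qed.

Lemma sq_map_big a : 4 <= `|a| -> 6 < nc sq_map.[a%:C%C].
Proof.
move=> a4; rewrite nc_sq_map nc_real.
suff : 4 <= \prod_(b <- r) nc (a%:C%C - (b ^+ 2)%:C%C).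
  move=> h; have : 4 * 4 <= `|a| * \prod_(b <- r) nc (a%:C%C - (b ^+ 2)%:C%C).
    by rewrite ler_pM.
  lra.
under eq_bigr => b _ do rewrite -rmorphB nc_real.
have [a0|a0] := leP 0 a.
  (* For positive a every factor is at least its value at s = 4 = 2^2, where the product is U_m(2)^2
     = m^2. For negative a, treated afterwards, each factor is already at least 4. *)
  apply: (@le_trans _ _ (\prod_(b <- r) nc (2 ^+ 2 - (b ^+ 2)%:C%C))).
    rewrite -nc_prod -continuant_sqr continuant_at2 ncX nc_nat -natrX ler_nat.
    by rewrite -[4%N]/(2 ^ 2)%N leq_exp2r.
  rewrite big_seq [leRHS]big_seq; apply: ler_prod => b /sqr_lt4 b4.
  have -> : 2 ^+ 2 = (2 ^+ 2)%:C%C :> C by rewrite rmorphXn rmorph_nat.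
  rewrite -rmorphB nc_real normr_ge0 /=; move: a4; rewrite ger0_norm // => a4.
  by rewrite !ger0_norm; lra.
apply: prod_ge; rewrite ?size_r ?ler1n // => b _.
move: a4; rewrite ltr0_norm // => a4; have := sqr_ge0 b => b0.
by rewrite ltr0_norm; lra.
Qed.

End SquaredMap.

(** * Bounded eigenvectors give spectrum *)

Section BoundedEigenvectors.
Variable R : realType.
Local Notation C := R[i].
Implicit Types (phi : int -> C) (c : int -> int) (lam : C).

Definition eigen_set : set C := [set lam | exists c phi K,
  [/\ sign_sequence c, Defs.periodic c, exists j, phi j != 0,
      forall j, nc (phi j) <= K
    & forall j, (c j)%:~R * phi (j - 1) + phi (j + 1) = lam * phi j]].

Lemma l2_sqsum_ge phi (s : seq int) : uniq s ->
  ((\sum_(m <- s) nc (phi m) ^+ 2)%:E <= l2_sqsum phi)%E.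
Proof.
move=> us; apply: esum_ge; exists [set` s]; first by split; [exact: finite_seq|].
by rewrite -fsbig_seq // sumEFin.
Qed.

Lemma l2_sqsum_seq phi (s : seq int) : uniq s -> (forall m, m \notin s -> phi m = 0) ->
  l2_sqsum phi = (\sum_(m <- s) nc (phi m) ^+ 2)%:E.
Proof.
move=> us h; rewrite -sumEFin fsbig_seq // -esum_fset; last 2 first.
- exact: finite_seq.
- by move=> i _; rewrite lee_fin sqr_ge0.
rewrite esum_mkcond; apply: eq_esum => m _; rewrite mem_setE.
by case: ifPn => // /h ->; rewrite nc0 expr0n.
Qed.

Lemma l2_sqsum_le phi (K : R) :
  (forall s : seq int, uniq s -> \sum_(m <- s) nc (phi m) ^+ 2 <= K) ->
  (l2_sqsum phi <= K%:E)%E.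
Proof.
move=> h; apply: ge_ereal_sup => _ [A [/finite_seqP [s ->] _] <-].
rewrite (_ : [set` s] = [set` undup s]); last first.
  by apply/seteqP; split=> m /=; rewrite mem_undup.
by rewrite -fsbig_seq ?undup_uniq // sumEFin lee_fin h ?undup_uniq.
Qed.

Lemma l2norm_sqr phi : l2 phi -> (l2norm phi ^+ 2)%:E = l2_sqsum phi.
Proof.
move=> h; have h0 : (0 <= l2_sqsum phi)%E.
  by apply: esum_ge0 => m _; rewrite lee_fin sqr_ge0.
by rewrite sqr_sqrtr ?fine_ge0 // fineK // ge0_fin_numE.
Qed.

(** Linearity is used with coefficient -1 and both vectors zero. *)
Lemma bounded_operator0 (B : (int -> C) -> int -> C) :
  bounded_operator B -> B (fun=> 0) = (fun=> 0).
Proof.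
have l20 : l2 (fun=> 0 : C).
  by rewrite /l2 /= (@l2_sqsum_seq _ [::]) // big_nil ltry.
case=> _ /(_ (-1) _ _ l20 l20) h _.
move: h; rewrite (_ : (fun _ : int => -1 * 0 + 0) = (fun=> 0 : C)); last first.
  by apply/funext => m; rewrite mulr0 addr0.
by move=> h; apply/funext => m; have := congr1 (@^~ m) h => /= ->; rewrite mulN1r addNr.
Qed.

(* A truncated bounded eigenvector is mapped by [A_c - lam] to a vector carried
   by four sites, so a bounded resolvent would force it into l2. *)
Lemma eigen_set_pi_infty : eigen_set `<=` pi_infty R.
Proof.
move=> lam [c [phi [K [csign cper [j0 phij0] phiK Aphi]]]].
exists c => //= -[B Bbd Binv].
have K0 : 0 <= K by rewrite (le_trans (nc_ge0 (phi 0))).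
pose A (f : int -> C) := fun m => hopping c f m - lam * f m.
pose K1 := K + K + nc lam * K.
have K10 : 0 <= K1 by rewrite !addr_ge0 ?mulr_ge0 ?nc_ge0.
have cut (L : nat) : exists f : int -> C,
    [/\ l2 f, l2 (A f), forall m, (`|m| <= L)%N -> f m = phi m & l2norm (A f) <= 2 * K1].
  pose f m := if (`|m| <= L)%N then phi m else 0.
  have fK m : nc (f m) <= K by rewrite /f; case: ifP => // _; rewrite nc0.
  have fl2 : l2 f.
    pose s := [seq k%:Z - L%:Z | k <- iota 0 (L + L).+1].
    have us : uniq s by rewrite map_inj_uniq ?iota_uniq // => x y; lia.
    rewrite /l2 /= (l2_sqsum_seq us) ?ltry // => m.
    rewrite /f; case: ifP => // hm /negP[]; apply/mapP; exists (absz (m + L%:Z)%R); last by lia.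
    by rewrite mem_iota; lia.
  (* Truncation breaks the eigenvalue equation only at these sites, which partly coincide for L = 0.
     At most four entries bounded by [K1] give the norm bound [2 * K1]. *)
  pose s := undup [:: L%:Z; - L%:Z; L.+1%:Z; - L.+1%:Z].
  have Afs m : m \notin s -> A f m = 0.
    rewrite mem_undup !inE !negb_or => /and4P[h1 h2 h3 h4].
    rewrite /A /hopping /f; have [hm|hm] := leqP `|m| L.
      rewrite ifT; last by lia.
      by rewrite ifT ?Aphi ?subrr //; lia.
    by rewrite ifF ?ifF ?mulr0 ?addr0 ?subr0 //; lia.
  have AfK m : nc (A f m) <= K1.
    rewrite /A /hopping (le_trans (ncB _ _)) // ncM lerD ?ler_wpM2l ?nc_ge0 //.
    rewrite (le_trans (ncD _ _)) // lerD // ncM.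
    have -> : nc ((c m)%:~R : C) = 1 by case: (csign m) => ->; rewrite ?mulrN1z ?ncN nc1.
    by rewrite mul1r.
  exists f; split=> //.
  - by rewrite /l2 /= (l2_sqsum_seq (undup_uniq _) Afs) ltry.
  - by move=> m hm; rewrite /f hm.
  rewrite /l2norm (l2_sqsum_seq (undup_uniq _) Afs) /=.
  rewrite -(@ler_pXn2r _ 2) ?nnegrE ?sqrtr_ge0 ?mulr_ge0 // sqr_sqrtr ?sumr_ge0 //.
    apply: (@le_trans _ _ (\sum_(m <- s) K1 ^+ 2)).
      by apply: ler_sum => m _; rewrite lerXn2r ?nnegrE ?nc_ge0.
    rewrite big_const_seq count_predT iter_addr_0 exprMn -[_ *+ size s]mulr_natl ler_wpM2r
      ?sqr_ge0 //.
    by rewrite -natrX ler_nat; exact: (size_undup [:: L%:Z; - L%:Z; L.+1%:Z; - L.+1%:Z]).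
  by move=> m _; rewrite sqr_ge0.
have [_ _ [M hM]] := Bbd.
have phil2 : l2 phi.
  rewrite /l2 /=; apply: le_lt_trans (ltry ((`|M| * (2 * K1)) ^+ 2)).
  (* Every finite set of sites lies in some [-L, L], and the bound on the truncation there does not
     depend on L. *)
  apply: l2_sqsum_le => s us; pose L := (\sum_(m <- s) `|m|)%N.
  have [f [fl2 Afl2 fphi fK]] := cut L.
  have [Bf _] := Binv _ fl2.
  have -> : \sum_(m <- s) nc (phi m) ^+ 2 = \sum_(m <- s) nc (f m) ^+ 2.
    apply: eq_big_seq => m ms; rewrite fphi // /L (big_rem m) //=; exact: leq_addr.
  rewrite -lee_fin (le_trans (l2_sqsum_ge _ us)) // -l2norm_sqr // lee_fin.
  rewrite lerXn2r ?nnegrE ?sqrtr_ge0 ?mulr_ge0 // -Bf.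
  rewrite (le_trans (hM _ Afl2)) // (le_trans (ler_norm _)) // normrM.
  by rewrite ler_wpM2l // ger0_norm ?sqrtr_ge0.
(* Now the inverse may be applied to [phi] itself, which is annihilated by the operator and would
   have to vanish. *)
have [+ _] := Binv _ phil2.
rewrite (_ : (fun m => _) = (fun=> 0)); last first.
  by apply/funext => m; rewrite /hopping Aphi subrr.
rewrite bounded_operator0 // => h.
by move: phij0; rewrite -h eqxx.
Qed.

End BoundedEigenvectors.

(** * Periodic sign sequences as coboundaries *)

Section Periodic.
Variables (e : int -> int) (N : nat).
Hypothesis N0 : (0 < N)%N.
Hypothesis eper : forall m, e (m + N%:Z) = e m.
Hypothesis esign : sign_sequence e.

Lemma periodicMn (k : nat) j : e (j + (k * N)%N%:Z) = e j.
Proof.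
elim: k j => [|k IHk] j; first by rewrite mul0n addr0.
by rewrite mulSn PoszD addrA IHk eper.
Qed.

Lemma periodicMz (k : int) j : e (j + k * N%:Z) = e j.
Proof.
case: k => k; first by rewrite -PoszM periodicMn.
by rewrite NegzE -(periodicMn k.+1) PoszM mulNr subrK.
Qed.

Let D n : int := \prod_(1 <= i < n.+1) - e i%:Z.

Let DS n : D n.+1 = D n * - e n.+1%:Z.
Proof. by rewrite /D big_nat_recr. Qed.

Let Dsign n : D n = 1 \/ D n = -1.
Proof.
elim: n => [|n IHn]; first by left; rewrite /D big_geq.
by rewrite DS; case: (esign n.+1%:Z) => ->; case: IHn => ->; [right|left|left|right].
Qed.

Let DaddN n : D (n + N) = D N * D n.
Proof.
elim: n => [|n IHn]; first by rewrite add0n [D 0]big_geq // mulr1.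
by rewrite addSn !DS IHn mulrA -addSn PoszD eper.
Qed.

Let D2N : D (N + N) = 1.
Proof. by rewrite DaddN; case: (Dsign N) => ->. Qed.

(** [d] consists of partial products of the - e_i. Over one period the product may be -1, so the
    period is doubled to make it 1. *)
Lemma sign_sequence_coboundary : exists d,
  [/\ sign_sequence d, Defs.periodic d & forall j, e j = - (d j * d (j - 1))].
Proof.
pose M := (N + N)%:Z; have M0 : M != 0 by rewrite /M; lia.
pose d j := D (absz (j %% M)%Z).
exists d; split=> [j|| j]; first exact: Dsign.
  exists (N + N)%N; first lia.
  by move=> m; rewrite /d -/M modzDr.
have Me k i : e (i + k * M) = e i.
  by rewrite /M PoszD mulrDr addrA !periodicMz.
have jE := divz_eq j M; have r0 := modz_ge0 j M0.
have rM : (j %% M)%Z < M by apply: ltz_pmod; rewrite /M; lia.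
set q := (j %/ M)%Z in jE; rewrite {2}/d; move: r0 rM jE; rewrite /d.
case: (j %% M)%Z => // r _ rM jE /=.
have ej : e j = e r by rewrite jE addrC Me.
case: r rM jE ej => [|r] rM jE ej.
  have -> : (j - 1 = (q - 1) * M + (N + N).-1%:Z)%R by rewrite jE /M; lia.
  rewrite modzMDl modz_small; last by rewrite /M; lia.
  (* At the wrap-around [d] falls back from [D (N + N).-1] to the empty product, consistently
     because [D (N + N) = 1]. *)
  have := D2N; rewrite -[X in D X](@prednK (N + N)); last by lia.
  rewrite /= DS prednK; last by lia.
  have -> : e (N + N)%N = e 0 by rewrite -[RHS](Me 1) add0r mul1r.
  rewrite ej [D 0]big_geq // mul1r.
  by case: (esign 0) => ->; case: (Dsign (N + N).-1) => ->.
have -> : (j - 1 = q * M + r%:Z)%R by rewrite jE; lia.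
rewrite modzMDl modz_small; last by lia.
rewrite /= DS ej mulrC mulrA mulrN opprK.
by case: (Dsign r) => ->; rewrite ?mul1r // mulrNN mul1r.
Qed.
End Periodic.

(** * Symmetries and block preimages of the set of eigenvalues *)

Section EigenSet.
Variable R : realType.
Local Notation C := R[i].
Local Notation U n := (continuant R 1 n).
Implicit Types (lam x : C).

Lemma nc_sign (c : int -> int) m : sign_sequence c -> nc ((c m)%:~R : C) = 1.
Proof. by move=> h; case: (h m) => ->; rewrite ?mulrN1z ?ncN nc1. Qed.

(** For c = 1 the powers of a unimodular z with z + 1/z = a form a bounded eigenvector. *)
Lemma eigen_set_segment (a : R) : `|a| <= 2 -> eigen_set a%:C%C.
Proof.
move=> a2; pose b := Num.sqrt (1 - (a / 2) ^+ 2).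
pose z : C := ((a / 2) +i* b)%C.
have b2 : b ^+ 2 = 1 - (a / 2) ^+ 2.
  rewrite sqr_sqrtr //; move: a2; rewrite ler_norml => /andP[h1 h2]; nra.
have nz : nc z = 1.
  by apply/eqP; rewrite -(@pexpr_eq1 _ _ 2) ?nc_ge0 // nc_sqr /= b2 addrC subrK.
have z0 : z != 0 by rewrite -nc_gt0 nz.
have hz : z ^+ 2 + 1 = a%:C%C * z.
  apply/eqP; rewrite eq_complex expr2; simpc; rewrite /=; simpc; rewrite /=.
  by apply/andP; split; apply/eqP; nra.
exists (fun=> 1), (fun n => z ^ n), 1; split.
- by left.
- by exists 1%N.
- by exists 0; rewrite expr0z oner_eq0.
- by case=> n; rewrite ?NegzE -?exprVn ?exprnN /= ?ncV ncX nz expr1n ?invr1.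
move=> n; rewrite mul1r.
have h1 : z ^ n = z ^ (n - 1) * z by rewrite -[in LHS](subrK 1 n) expfzDr // expr1z.
have h2 : z ^ (n + 1) = z ^ (n - 1) * z ^+ 2 by rewrite expfzDr // expr1z h1; ring.
rewrite h2 h1; transitivity (z ^ (n - 1) * (z ^+ 2 + 1)); first by ring.
by rewrite hz; ring.
Qed.

(** Conjugation by the diagonal operator with entries i^j turns c into -c and multiplies eigenvalues
    by i. *)
Lemma eigen_set_muli lam : eigen_set lam -> eigen_set ('i%C * lam).
Proof.
move=> [c [phi [K [csign [N N0 cper] [j0 phij0] phiK Aphi]]]].
have i0 : 'i%C != 0 :> C by rewrite -nc_gt0 nci.
have ni n : nc (('i%C : C) ^ n) = 1.
  by case: n => n; rewrite ?NegzE -?exprnN /= ?ncV ncX nci expr1n ?invr1.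
exists (fun j => - c j), (fun j => 'i%C ^ j * phi j), K; split.
- by move=> m; case: (csign m) => ->; [right|left].
- by exists N => // m; rewrite cper.
- by exists j0; rewrite mulf_neq0 // -nc_gt0 ni.
- by move=> j; rewrite ncM ni mul1r.
move=> j; rewrite !expfzDr // expr1z [in RHS]mulrACA -mulrA [_ * phi j]mulrC.
rewrite exprN1 rmorphN /=.
have -> : ('i%C)^-1 = - 'i%C :> C.
  by apply: (mulfI i0); rewrite mulfV // mulrN -expr2 sqr_i opprK.
transitivity ('i%C * 'i%C ^ j * ((c j)%:~R * phi (j - 1) + phi (j + 1))); first by ring.
by rewrite Aphi; ring.
Qed.

Lemma continuant_cassini n (x : C) :
  (U n.+1).[x] ^+ 2 - (U n.+2).[x] * (U n).[x] = 1.
Proof.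
elim: n => [|n IHn]; first by rewrite horner_continuantSS !hornerC; ring.
by rewrite (horner_continuantSS n.+1) -IHn (horner_continuantSS n); ring.
Qed.

(* Given a bounded eigenvector [X] for [e], write [e_j = - d_j d_(j-1)] and place
   [X_j] at site [m j], with weights [d_j] to its left and [- d_j] to its right
   and [1] elsewhere: eliminating the [m - 1] sites in between leaves
   [P_m(lam) X_j = e_j X_(j-1) + X_(j+1)], as the two diagonal contributions
   [d_j U_(m-1) / U_m] of the neighbouring blocks cancel. *)
Lemma eigen_set_preimage n lam : (U n.+2).[lam] != 0 ->
  eigen_set (lam * (U n.+2).[lam]) -> eigen_set lam.
Proof.
move=> Um0 [e [X [K [esign [N N0 eper] [j0 Xj0] XK AX]]]].
have [d [dsign [M M0 dper] ed]] := sign_sequence_coboundary N0 eper esign.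
pose m := n.+2; pose u k := (U k).[lam].
have uS k : u k.+2 = lam * u k.+1 - u k by exact: horner_continuantSS.
pose dC j : C := (d j)%:~R.
have dC2 j : dC j * dC j = 1.
  by rewrite /dC -intrM; case: (dsign j) => ->.
have eC j : (e j)%:~R = - (dC j * dC (j - 1)) :> C by rewrite ed rmorphN rmorphM.
(* [y j] is the value at the first site after [j * m]; it is chosen so that the recurrence across
   the block, solved by [Y j], arrives at [X (j + 1)]. *)
have [y yE] : exists y : int -> C, forall j,
  y j = (X (j + 1) - dC j * u n.+1 * X j) / u m by eexists.
pose Y j r := u r * y j + dC j * u r.-1 * X j.
pose c (k : int) := if (k %% m)%Z == 0 then d (k %/ m)%Z
  else if (k %% m)%Z == 1 then - d (k %/ m)%Z else 1.
pose phi (k : int) := if (k %% m)%Z == 0 then X (k %/ m)%Z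
  else Y (k %/ m)%Z (absz (k %% m)%Z).
have m0 : m%:Z != 0 by [].
have dm j r : (r < m)%N -> (((j * m%:Z + r%:Z) %/ m)%Z = j) * (((j * m%:Z + r%:Z) %% m)%Z = r%:Z).
  by move=> rm; rewrite divzMDl // modzMDl divz_small ?modz_small ?addr0.
have Ym j : Y j m = X (j + 1).
  by rewrite /Y yE /=; field.
have phi0 j : phi (j * m%:Z) = X j.
  by have [h1 h2] := dm j 0%N isT; rewrite /phi -[j * m%:Z]addr0 h1 h2.
have phiY j r : (0 < r <= m)%N -> phi (j * m%:Z + r%:Z) = Y j r.
  move=> /andP[r0]; rewrite leq_eqVlt => /orP[/eqP->|rm].
    by rewrite Ym -phi0; congr phi; lia.
  by have [h1 h2] := dm j r rm; rewrite /phi h1 h2; case: r r0 {rm h1 h2}.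
have c0 j : c (j * m%:Z) = d j.
  by have [h1 h2] := dm j 0%N isT; rewrite /c -[j * m%:Z]addr0 h1 h2.
have c1 j : c (j * m%:Z + 1) = - d j.
  by have [h1 h2] := dm j 1%N isT; rewrite /c h1 h2.
have cr j r : (1 < r < m)%N -> c (j * m%:Z + r%:Z) = 1.
  move=> /andP[r1 rm]; have [h1 h2] := dm j r rm.
  by rewrite /c h1 h2; case: r r1 {rm h1 h2} => [|[]].
have repr k : exists j r, (r < m)%N /\ k = j * m%:Z + r%:Z.
  exists (k %/ m)%Z, (absz (k %% m)%Z).
  have := modz_ge0 k m0; have := @ltz_pmod k m isT; have := divz_eq k m.
  by case: (k %% m)%Z => // r h1 h2 _; split; lia.
pose W := \sum_(k < m.+1) nc (u k).
have uW k : (k <= m)%N -> nc (u k) <= W.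
  move=> km; rewrite /W (bigD1 (inord k)) //= inordK // lerDl sumr_ge0 // => i _.
  exact: nc_ge0.
have W0 : 0 <= W by rewrite sumr_ge0 // => i _; exact: nc_ge0.
have K0 : 0 <= K by rewrite (le_trans (nc_ge0 (X 0))).
pose Ky := (K + W * K) / nc (u m).
have yK j : nc (y j) <= Ky.
  rewrite yE ncM ncV ler_wpM2r ?invr_ge0 ?nc_ge0 // (le_trans (ncB _ _)) // lerD //.
  by rewrite !ncM nc_sign // mul1r ler_pM ?nc_ge0 ?uW.
exists c, phi, (K + (W * Ky + W * K)); split.
- move=> k; have [j [r [rm ->]]] := repr k.
  case: r rm => [|[|r]] rm; first by rewrite addr0 c0.
    by rewrite c1; case: (dsign j) => ->; [right|left].
  by rewrite cr //; left.
- exists (M * m)%N; first by rewrite muln_gt0 M0.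
  move=> k; have -> : (M * m)%N%:Z = M%:Z * m%:Z by rewrite PoszM.
  by rewrite /c addrC modzMDl divzMDl // [M%:Z + _]addrC dper.
- by exists (j0 * m%:Z); rewrite phi0.
- have Ky0 : 0 <= Ky by rewrite (le_trans (nc_ge0 (y 0))).
  have WKy0 : 0 <= W * Ky by exact: mulr_ge0.
  have WK0 : 0 <= W * K by exact: mulr_ge0.
  move=> k; have [j [r [rm ->]]] := repr k.
  case: r rm => [|r] rm.
    by rewrite addr0 phi0 (le_trans (XK _)) // lerDl addr_ge0.
  rewrite phiY ?(ltnW rm) // /Y (le_trans (ncD _ _)) // ler_wpDl // !ncM nc_sign // mul1r.
  by rewrite lerD // ler_pM ?nc_ge0 ?uW //; lia.
move=> k; have [j [r [rm ->]]] := repr k.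
case: r rm => [|[|r]] rm.
- rewrite addr0 c0 phi0.
  have -> : j * m%:Z - 1 = (j - 1) * m%:Z + n.+1%:Z by rewrite /m; lia.
  rewrite !phiY ?leqnSn // /Y /= !yE -/m subrK -/(dC j).
  have cas := continuant_cassini n lam; rewrite -/(u n.+1) -/(u n.+2) -/(u n) in cas.
  have := AX j; rewrite eC -/(u m) => AXj.
  have -> : X (j + 1) = lam * u m * X j + dC j * dC (j - 1) * X (j - 1).
    by rewrite -AXj; ring.
  move: (X j) (X (j - 1)) (dC j) (dC (j - 1)) => x1 x0 d1 d0.
  (* What remains besides [lam * x1] is a multiple of 1 minus the Cassini expression. *)
  transitivity (lam * x1 + d1 * d0 * x0 * (1 - (u n.+1 ^+ 2 - u m * u n)) / u m).
    by rewrite /u !hornerC; field.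
  by rewrite cas subrr mulr0 mul0r addr0.
- rewrite c1 addrK phi0 -addrA phiY // phiY // /Y /= uS /u !hornerC rmorphN /= -/(dC j).
  by ring.
rewrite cr // mul1r.
have -> : j * m%:Z + r.+2%:Z - 1 = j * m%:Z + r.+1%:Z by lia.
have -> : j * m%:Z + r.+2%:Z + 1 = j * m%:Z + r.+3%:Z by lia.
rewrite !phiY; try lia.
by rewrite /Y /= (uS r.+1) (uS r); ring.
Qed.

End EigenSet.

(** * Small values of sin (k t) *)

Section Dirichlet.
Variable R : realType.

Lemma sinDpin (x : R) n : sin (x + n%:R * pi) = (-1) ^+ n * sin x.
Proof.
elim: n => [|n IHn]; first by rewrite mul0r addr0 mul1r.
by rewrite -natr1 mulrDl mul1r addrA sinDpi IHn exprS mulN1r mulNr.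
Qed.

Lemma cosDpin (x : R) n : cos (x + n%:R * pi) = (-1) ^+ n * cos x.
Proof.
elim: n => [|n IHn]; first by rewrite mul0r addr0 mul1r.
by rewrite -natr1 mulrDl mul1r addrA cosDpi IHn exprS mulN1r mulNr.
Qed.

(** Dirichlet's pigeonhole argument: among N + 1 fractional parts of k t/pi two differ by less than
    1/N, and the difference of their indices brings k t within pi/N of a multiple of pi. *)
Lemma small_sin_multiple (t e : R) : 0 <= t -> 0 < e ->
  exists2 k, (0 < k)%N & `|sin (k%:R * t)| < e.
Proof.
move=> t0 e0.
have [d d0 hd] : exists2 d : R, 0 < d & forall y, `|y| < d -> `|sin y| < e.
  have /cvgrPdist_lt /(_ _ e0) := @continuous_sin R 0.
  move=> /nbhs_ballP [d d0 hd]; exists d => // y yd.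
  have := hd y; rewrite /ball /= sub0r normrN => /(_ yd).
  by rewrite sin0 sub0r normrN.
have pi0 := pi_gt0 R.
pose a := t / pi; pose N := (Num.truncn (pi / d)).+1.
have N0 : (0 : R) < N%:R by rewrite ltr0n.
have piN : pi / N%:R < d.
  by rewrite ltr_pdivrMr // mulrC -ltr_pdivrMr // truncnS_gt.
pose x (k : nat) := k%:R * a - (Num.truncn (k%:R * a))%:R.
have x01 k : 0 <= x k < 1.
  have /truncn_itv : 0 <= k%:R * a by rewrite mulr_ge0 // divr_ge0 // ltW.
  by rewrite /x -natr1 => /andP[h1 h2]; apply/andP; split; lra.
have fN (k : 'I_N.+1) : (Num.truncn (N%:R * x k) < N)%N.
  have /andP[h1 h2] := x01 k.
  by rewrite truncn_lt_nat ?mulr_ge0 // gtr_pMr.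
have [k [l [kl fkl]]] : exists k l : 'I_N.+1, (k < l)%N /\ Num.truncn (N%:R * x k) =
  Num.truncn (N%:R * x l).
  pose f (k : 'I_N.+1) : 'I_N := Ordinal (fN k).
  have : ~~ injectiveb f.
    by apply/negP => /injectiveP /leq_card; rewrite !card_ord ltnn.
  case/injectivePn => k [l kl [fkl]].
  by have [h|h|/val_inj h] := ltngtP k l; [exists k, l|exists l, k|move: kl; rewrite h eqxx].
exists (l - k)%N; first by rewrite subn_gt0.
have xkl : `|x l - x k| < N%:R^-1.
  have /andP[k0 _] := x01 k; have /andP[l0 _] := x01 l.
  have /truncn_itv : 0 <= N%:R * x k by rewrite mulr_ge0.
  have /truncn_itv : 0 <= N%:R * x l by rewrite mulr_ge0.
  rewrite fkl -natr1 => /andP[h1 h2] /andP[h3 h4].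
  rewrite -[ltRHS]mul1r ltr_pdivlMr // -[X in _ * X < _](ger0_norm (ltW N0)) -normrM.
  by rewrite ltr_norml mulrBl ![_ * N%:R]mulrC; apply/andP; split; lra.
have tE (j : nat) : j%:R * t = pi * x j + (Num.truncn (j%:R * a))%:R * pi.
  by rewrite /x /a; field; lra.
have -> : (l - k)%:R * t = l%:R * t - k%:R * t by rewrite natrB ?mulrBl // ltnW.
rewrite sinB !tE !sinDpin !cosDpin.
set s1 := (-1) ^+ _; set s2 := (-1) ^+ _.
have -> : s1 * sin (pi * x l) * (s2 * cos (pi * x k)) - s1 * cos (pi * x l) * (s2 * sin (pi * x k))
  = s1 * s2 * sin (pi * x l - pi * x k) by rewrite sinB; ring.
rewrite !normrM !normrX normrN normr1 !expr1n !mul1r hd // -mulrBr normrM gtr0_norm //.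
by rewrite (lt_trans _ piN) // ltr_pM2l.
Qed.

End Dirichlet.

(** * The closure of the eigenvalues, the unit disc and the interval (-2, 2) *)

Section PeriodicSpectrumClosure.
Variable R : realType.
Local Notation C := R[i].
Local Notation U n := (continuant R 1 n).
Implicit Types (x z lam : C).

Definition eigen_closure : set C :=
  [set x | forall e : R, 0 < e -> exists2 y, eigen_set y & nc (x - y) < e].

Local Notation Sg := eigen_closure.

Lemma eigen_closure_Sigma_pi : Sg `<=` Sigma_pi R.
Proof.
move=> x hx B /nbhs_ballP [e /= e0 hB].
(* Balls have radii in [R[i]]; a positive radius is necessarily real. *)
have eE : e = (complex.Re e)%:C%C by case: e e0 {hB} => a b; rewrite ltcE /= => /andP[/eqP -> _].
have [y yE xy] : exists2 y, eigen_set y & nc (x - y) < complex.Re e.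
  by apply: hx; move: e0; rewrite ltcE => /andP[].
exists y; split; first exact: eigen_set_pi_infty.
have : (nc (x - y))%:C%C < (complex.Re e)%:C%C :> C by rewrite ltcR.
rewrite -eE => h; by apply: hB; rewrite -ball_normE.
Qed.

Lemma eigen_closure_closed x : ~ Sg x ->
  exists2 r, 0 < r & forall t, nc (t - x) <= r -> ~ Sg t.
Proof.
move=> nx; apply: contrapT => hr; apply: nx => e e0; apply: contrapT => he.
apply: hr; exists (e / 2) => [|t tx ht]; first by rewrite divr_gt0.
have [|y yE ty] := ht (e / 2); first by rewrite divr_gt0.
apply: he; exists y => //.
have -> : x - y = (t - y) - (t - x) by ring.
by rewrite (le_lt_trans (ncB _ _)) //; lra.
Qed.

Lemma eigen_closure_lim x :
  (forall e : R, 0 < e -> exists2 y, Sg y & nc (x - y) < e) -> Sg x.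
Proof.
move=> h; apply: contrapT => /eigen_closure_closed [r r0 hr].
by have [y yS xy] := h _ r0; apply: (hr y) => //; rewrite nc_distC ltW.
Qed.

Lemma eigen_closure_muli x : Sg x -> Sg ('i%C * x).
Proof.
move=> hx e /hx [y yE xy]; exists ('i%C * y); first exact: eigen_set_muli.
by rewrite -mulrBr ncM nci mul1r.
Qed.

Lemma eigen_closure_opp x : Sg x -> Sg (- x).
Proof.
move=> /eigen_closure_muli /eigen_closure_muli.
by rewrite mulrA -expr2 sqr_i mulN1r.
Qed.

Lemma eigen_closure_divi x : Sg ('i%C * x) -> Sg x.
Proof.
move=> /eigen_closure_muli /eigen_closure_opp.
by rewrite mulrA -expr2 sqr_i mulN1r opprK.
Qed.

Lemma eigen_closure_segment (a : R) : `|a| <= 2 -> Sg a%:C%C.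
Proof.
move=> /eigen_set_segment h e e0; exists a%:C%C => //.
by rewrite subrr nc0.
Qed.

(** Preimages can be taken only where U_m does not vanish, so approximation by the eigenvalue 0 is
    replaced by small real eigenvalues. *)
Lemma eigen_closure_nz x (e : R) : Sg x -> 0 < e ->
  exists y, [/\ eigen_set y, y != 0 & nc (x - y) < e].
Proof.
move=> hx e0; have e2 : 0 < e / 2 by rewrite divr_gt0.
have [y yE xy] := hx _ e2.
have [y0|y0] := eqVneq y 0; last by exists y; split=> //; lra.
pose a : R := Num.min (e / 4) 1.
have a0 : 0 < a by rewrite lt_min divr_gt0 //=.
have a1 : a <= 1 by rewrite ge_min lexx orbT.
have ae : a <= e / 4 by rewrite ge_min lexx.
exists a%:C%C; split.
- by apply: eigen_set_segment; rewrite ger0_norm ?ltW //; lra.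
- by rewrite -nc_gt0 nc_real normr_gt0 gt_eqF.
move: xy; rewrite y0 subr0 => xy.
by rewrite (le_lt_trans (ncB _ _)) // nc_real gtr0_norm //; lra.
Qed.

(** If y is within e^m of P_m(lam), the monic polynomial P_m - y of degree m = n + 2 has a root
    within e of lam, as otherwise its value there would be at least e^m. *)
Lemma eigen_closure_preimage n lam : Sg (lam * (U n.+2).[lam]) -> Sg lam.
Proof.
move=> h e e0; have [y [yE y0 ly]] := eigen_closure_nz h (exprn_gt0 n.+2 e0).
have [mU sU] := continuant_monic R n.+1.
pose P := 'X * U n.+2.
have sP : size P = n.+3 by rewrite /P mulrC size_mulX ?sU // monic_neq0.
have sy : (size (- y%:P) < size P)%N.
  by rewrite size_polyN sP (leq_ltn_trans (size_polyC_leq1 _)).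
have [r Dr] := closed_field_poly_normal (P - y%:P).
have mPy : P - y%:P \is monic.
  by rewrite monicE lead_coefDl // -monicE /P monicMl ?monicX.
rewrite (monicP mPy) scale1r in Dr.
have sr : size r = n.+2.
  have : size (P - y%:P) = n.+3 by rewrite size_polyDl.
  by rewrite Dr size_prod_XsubC => -[].
have PE z : z * (U n.+2).[z] - y = \prod_(b <- r) (z - b).
  have := congr1 (horner^~ z) Dr.
  rewrite hornerD hornerN hornerC hornerM hornerX horner_prod => ->.
  by apply: eq_bigr => b _; rewrite hornerXsubC.
have [b br lb] : exists2 b, b \in r & nc (lam - b) < e.
  apply: contrapT => hb; move: ly; rewrite PE nc_prod ltNge => /negP; apply.
  have : {in r, forall b, e <= nc (lam - b)}.
    by move=> b br; rewrite leNgt; apply/negP => lb; apply: hb; exists b.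
  rewrite -sr; elim: (r) => [|b s IHs] hs; first by rewrite big_nil expr0.
  rewrite big_cons /= exprS; apply: ler_pM; rewrite ?exprn_ge0 ?(ltW e0) ?hs ?mem_head //.
  by apply: IHs => b' b's; rewrite hs // inE b's orbT.
have /eqP := PE b; rewrite (big_rem b) //= subrr mul0r subr_eq0 => /eqP by_.
exists b => //; apply: (@eigen_set_preimage _ n); last by rewrite by_.
by apply: contraNneq y0 => u0; rewrite -by_ u0 mulr0.
Qed.

Lemma eigen_closure_sqrt z : Sg (z ^+ 2) -> Sg z.
Proof.
by move=> h; apply: (@eigen_closure_preimage 0); rewrite horner_continuantSS !hornerC mulr1
  subr0 -expr2.
Qed.

(* Repeated square roots of [0, 1] are dense in the unit disc. *)
Lemma eigen_closure_approx n z : nc z <= 1 -> exists f,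
  [/\ Sg f, nc f = nc z & nc (z - f) ^+ 2 * 2 ^+ n <= 4 * nc z ^+ 2].
Proof.
elim: n z => [|n IHn] z z1.
  exists (nc z)%:C%C; rewrite nc_real ger0_norm ?nc_ge0 //; split=> //.
    by apply: eigen_closure_segment; rewrite ger0_norm ?nc_ge0 //; lra.
  have := ncB z (nc z)%:C%C; rewrite nc_real ger0_norm ?nc_ge0 //.
  have := nc_ge0 z; have := nc_ge0 (z - (nc z)%:C%C); rewrite mulr1; nra.
have [|g [gS ng hg]] := IHn (z ^+ 2); first by rewrite ncX exprn_ile1 ?nc_ge0.
pose f := sqrtC g; have fg : f ^+ 2 = g by rewrite sqrtCK.
have nf : nc f = nc z.
  by apply/eqP; rewrite -(@eqrXn2 _ 2) ?nc_ge0 // -!ncX fg ng.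
have fS : Sg f by apply: eigen_closure_sqrt; rewrite fg.
(* The parallelogram law: the squared distances from z to f and -f sum to 4 |z|^2, and their product
   is the squared distance from z^2 to g. The nearer root therefore gains a factor 2, which is
   [key]. *)
have par : nc (z - f) ^+ 2 + nc (z + f) ^+ 2 = 4 * nc z ^+ 2.
  have : nc f ^+ 2 = nc z ^+ 2 by rewrite nf.
  by rewrite !nc_sqr; case: (z) (f) => a b [c d] /=; lra.
have prod : nc (z - f) ^+ 2 * nc (z + f) ^+ 2 * 2 ^+ n <= 4 * nc z ^+ 2 * nc z ^+ 2.
  rewrite -exprMn -ncM -subr_sqr fg (le_trans hg) // ncX -mulrA -expr2.
  by rewrite -!exprM.
have key (A B r p : R) : 0 <= A -> 0 <= r -> 0 < p -> A <= B -> A + B = 4 * r -> A * B * p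
  <= 4 * r * r ->
    A * (2 * p) <= 4 * r.
  move=> A0 r0 p0 AB ABr ABp.
  have B2 : 2 * r <= B by lra.
  have [r1|r1] := ltP 0 r; last by have -> : A = 0 by [lra]; rewrite mul0r; lra.
  rewrite -(ler_pM2r r1); have : 0 <= A * p by rewrite mulr_ge0 // ltW.
  nra.
have p0 : 0 < (2 : R) ^+ n by rewrite exprn_gt0.
have [h|h] := leP (nc (z - f) ^+ 2) (nc (z + f) ^+ 2).
  exists f; split=> //; rewrite [2 ^+ n.+1]exprS; apply: (key _ (nc (z + f) ^+ 2)); rewrite
    ?sqr_ge0 //.
exists (- f); split; [exact: eigen_closure_opp|by rewrite ncN|].
rewrite [2 ^+ n.+1]exprS opprK; apply: (key _ (nc (z - f) ^+ 2)); rewrite ?sqr_ge0 ?(ltW h) //.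
  by rewrite addrC.
by rewrite [X in X * _ <= _]mulrC.
Qed.

Lemma eigen_closure_disc z : nc z < 1 -> Sg z.
Proof.
move=> z1; apply: eigen_closure_lim => e e0.
(* 24 = 6 * 4 yields 4 < e^2 2^n, which beats the bound 4 |z|^2. *)
have [n hn] := exists_expr2_gt (24 / e ^+ 2).
have [f [fS nf hf]] := eigen_closure_approx n (ltW z1).
exists f => //; rewrite -(@ltr_pXn2r _ 2) ?nnegrE ?nc_ge0 ?(ltW e0) //.
have p0 : 0 < (2 : R) ^+ n by rewrite exprn_gt0.
rewrite -(ltr_pM2r p0) (le_lt_trans hf) //.
move: hn; rewrite ltr_pdivrMr ?exprn_gt0 // => hn.
have : nc z ^+ 2 < 1 by rewrite exprn_ilt1 ?nc_ge0.
lra.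
Qed.

(* [P_k(2 cos t) = 2 cos t sin (k t) / sin t] is small for suitable [k]. *)
Lemma eigen_closure_real_interior (a : R) : `|a| < 2 ->
  exists2 r, 0 < r & forall t, nc (t - a%:C%C) < r -> Sg t.
Proof.
move=> a2; have ha : -1 < a / 2 < 1.
  by move: a2; rewrite ltr_norml => /andP[h1 h2]; apply/andP; split; lra.
have /andP[ha1 ha2] := ha.
have hab : -1 <= a / 2 <= 1 by rewrite !ltW.
pose t := acos (a / 2); have ct : 2 * cos t = a.
  by rewrite /t acosK ?in_itv //; field.
have st : 0 < sin t by rewrite sin_acos // sqrtr_gt0; nra.
(* By sin (2 k t) = 2 sin (k t) cos (k t) and |a| < 2, the bound sin t / 4 makes |P_(2k)(a)| < 1;
   the even index 2k is at least 2. *)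
have [|k k0 hk] := @small_sin_multiple R t (sin t / 4) (acos_ge0 hab); first by rewrite divr_gt0.
have [n nk] : exists n, n.+2 = (2 * k)%N by exists (2 * k - 2)%N; lia.
have small : nc (a%:C%C * (U n.+2).[a%:C%C]) < 1.
  have := continuant_trig n.+2 t; rewrite ct => /(congr1 nc).
  rewrite !ncM !nc_real (gtr0_norm st) => h.
  rewrite -(ltr_pM2r st) mul1r -mulrA h nk.
  have -> : (2 * k)%:R * t = k%:R * t + k%:R * t by rewrite natrM; ring.
  rewrite sinD [cos _ * _]mulrC -mulr2n normrMn normrM.
  have c1 : `|cos (k%:R * t)| <= 1 by rewrite ler_norml cos_geN1 cos_le1.
  have : `|sin (k%:R * t)| * `|cos (k%:R * t)| <= `|sin (k%:R * t)| by rewrite ler_piMr.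
  set u := _ * _ => hu.
  have u0 : 0 <= u by rewrite mulr_ge0.
  have : `|a| * (u *+ 2) <= 2 * (u *+ 2) by rewrite ler_wpM2r ?mulrn_wge0 // ltW.
  rewrite -mulr_natl; lra.
pose P := 'X * U n.+2.
have PE z : P.[z] = z * (U n.+2).[z] by rewrite hornerM hornerX.
have e0 : 0 < (1 - nc P.[a%:C%C]) / 2 by rewrite divr_gt0 // subr_gt0 PE.
have [d d0 hd] := horner_continuous_at P a%:C%C e0.
exists d => // z /ltW /hd h; apply: (@eigen_closure_preimage n); rewrite -PE.
by apply: eigen_closure_disc; have := nc_dist P.[z] P.[a%:C%C]; lra.
Qed.

End PeriodicSpectrumClosure.

(** * From bounded orbits to filled Julia sets *)

Section FilledJulia.
Variable R : realType.
Local Notation C := R[i].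
Local Notation U n := (continuant R 1 n).
Local Notation Sg := (@eigen_closure R).

Lemma filled_julia_bounded (p : {poly C}) z : filled_julia p z ->
  exists M : R, forall n, nc (iter n (horner p) z) <= M.
Proof.
move=> /pinfty_ex_gt0 [M _ hM]; exists (complex.Re M) => n.
have : (nc (iter n (horner p) z))%:C%C <= M by exact: (hM n Logic.I).
by rewrite lecE => /andP[].
Qed.

(* Passing to [s = x ^ 2] turns the maps [eta P_m], [eta ^ 4 = 1], into a
   polynomial map [sq_map] with real coefficients and real critical points. *)
Lemma eigen_closure_bounded_sq_orbit n (r : seq R) (sg : R) z M :
    size r = n.+1 -> U n.+2 = \prod_(a <- r) ('X - a%:C%C%:P) ->
    all (fun a => `|a| < 2) r -> sg = 1 \/ sg = -1 ->
    (forall k, nc (iter k (horner (sq_map r sg)) (z ^+ 2)) <= M) ->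
  Sg z.
Proof.
move=> sr Ur r2 sg1 hM.
have sgn : `|sg| = 1 by case: sg1 => ->; rewrite ?normrN normr1.
(* Since [Sg] is symmetric under sign change, this is the image of [Sg] under squaring. *)
pose S : set C := [set s | forall x, x ^+ 2 = s -> Sg x].
suff : S (z ^+ 2) by apply.
have SE x : Sg x -> S (x ^+ 2).
  move=> hx y /eqP; rewrite eqf_sqr => /orP[/eqP-> //|/eqP->].
  exact: eigen_closure_opp.
have [c [b0 [s DG]]] := deriv_sq_map sg sr.
apply: (bounded_orbit_in (G := sq_map r sg) (c := c) (b0 := b0) (s := s) _ DG _ _ _ _ _ _ hM).
- exact: sq_map_real.
- move=> s0 hs x xs; apply: (@eigen_closure_preimage _ n).
  case: sg1 hs => ->; rewrite -xs (sq_map_sqr _ sr Ur).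
    by apply; rewrite mul1r.
  (* The sign -1 is the square of i, and [Sg] is invariant under i. *)
  move=> hs; apply/eigen_closure_divi/hs.
  by rewrite exprMn sqr_i rmorphN.
- move=> x x1 y yx; apply: eigen_closure_disc.
  by rewrite -(@ltr_pXn2r _ 2) ?nnegrE ?nc_ge0 // -ncX yx expr1n.
- move=> s0 ns; pose x0 := sqrtC s0; have xs : x0 ^+ 2 = s0 by rewrite sqrtCK.
  have nx : ~ Sg x0 by move=> /SE; rewrite xs.
  have [d d0 hd] := eigen_closure_closed nx.
  exists (d ^+ 2) => [|t ts hS]; first by rewrite exprn_gt0.
  pose y := sqrtC t; have yt : y ^+ 2 = t by rewrite sqrtCK.
  (* |t - s0| factors over the square roots, so y or -y lies within d of [x0]. *)
  have : nc (y - x0) * nc (y + x0) <= d ^+ 2 by rewrite -ncM -subr_sqr yt xs.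
  have [yx|yx] := leP (nc (y - x0)) d; first by have := hd _ yx (hS y yt).
  have [yx'|yx'] := leP (nc (y + x0)) d.
    by case: (hd (- y)); [rewrite -opprD ncN|apply: hS; rewrite sqrrN].
  by rewrite leNgt expr2 ltr_pM // ltW.
- move=> a a4.
  (* A real a in (-4, 4) is (eta x)^2 with x in (-2, 2) and eta = 1 or i according to its sign; this
     reduces to the interior of the real segment. *)
  have [x [x2 hx]] : exists x : R, `|x| < 2 /\ exists eta : C, 
      [/\ eta ^+ 2 * (x%:C%C) ^+ 2 = a%:C%C, nc eta = 1 & forall w, Sg (eta * w) <-> Sg w].
    exists (Num.sqrt `|a|); split.
      rewrite ger0_norm ?sqrtr_ge0 // -(@ltr_pXn2r _ 2) ?nnegrE ?sqrtr_ge0 //.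
      by rewrite sqr_sqrtr //; lra.
    have [a0|a0] := leP 0 a.
      exists 1; split; rewrite ?nc1 //; last by move=> w; rewrite mul1r.
      by rewrite expr1n mul1r -rmorphXn /= sqr_sqrtr // ger0_norm.
    exists 'i%C; split; rewrite ?nci //.
      by rewrite sqr_i -rmorphXn /= sqr_sqrtr // ltr0_norm // rmorphN mulN1r opprK.
    by move=> w; split; [exact: eigen_closure_divi|exact: eigen_closure_muli].
  have [eta [ea n1 heta]] := hx.
  have [d d0 hd] := eigen_closure_real_interior x2.
  exists (d ^+ 2) => [|t ts y yt]; first by rewrite exprn_gt0.
  have eta0 : eta != 0 by rewrite -nc_gt0 n1.
  pose w := eta^-1 * y.
  have yE : y = eta * w by rewrite /w mulVKf.
  suff : Sg w by rewrite yE => /heta.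
  have : nc (w - x%:C%C) * nc (w + x%:C%C) < d ^+ 2.
    rewrite -ncM -subr_sqr -[nc _]mul1r -(expr1n _ 2) -n1 -ncX -ncM mulrBr ea.
    by rewrite -exprMn -yE yt.
  have [wx|wx] := ltP (nc (w - x%:C%C)) d; first by move=> _; apply: hd.
  have [wx'|wx'] := ltP (nc (w + x%:C%C)) d.
    move=> _; rewrite -[w]opprK; apply/eigen_closure_opp/hd.
    by rewrite -opprD ncN.
  by rewrite ltNge expr2 ler_pM // ltW.
- by move=> x; exact: (sq_map_escape sr r2 sgn).
by move=> a; exact: (sq_map_big sr Ur r2 sgn).
Qed.

Lemma filled_julia_P m : (2 <= m)%N -> filled_julia (P_poly R m) `<=` Sg.
Proof.
case: m => [|[|n]] // _ z /filled_julia_bounded [M hM].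
have [r sr [Ur r2]] := continuant_real_rooted R n.
apply: (@eigen_closure_bounded_sq_orbit n r 1 z (M ^+ 2)) => //; first by left.
move=> k; have -> : iter k (horner (sq_map r 1)) (z ^+ 2) = (iter k (horner (P_poly R
  n.+2)) z) ^+ 2.
  elim: k => [//|k IHk]; rewrite !iterS IHk (sq_map_sqr _ sr Ur) mul1r.
  by rewrite horner_p_poly_P_vec.
by rewrite ncX lerXn2r ?nnegrE ?nc_ge0 // (le_trans (nc_ge0 _) (hM k)).
Qed.

(** In the variable w = i z the map becomes i^(1-m) P_m(w), so squaring gives [sq_map] with sign
    (-1)^(m-1). *)
Lemma filled_julia_Pstar m : (2 <= m)%N -> filled_julia (Pstar_poly R m) `<=` Sg.
Proof.
case: m => [|[|n]] // _ z /filled_julia_bounded [M hM].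
have [r sr [Ur r2]] := continuant_real_rooted R n.
apply: eigen_closure_divi.
apply: (@eigen_closure_bounded_sq_orbit n r ((-1) ^+ n.+1) _ (M ^+ 2)) => //.
  by rewrite -signr_odd; case: (odd _); [right|left].
move=> k; have -> : iter k (horner (sq_map r ((-1) ^+ n.+1))) (('i%C * z) ^+ 2)
    = ('i%C * iter k (horner (Pstar_poly R n.+2)) z) ^+ 2.
  elim: k => [//|k IHk]; rewrite !iterS IHk (sq_map_sqr _ sr Ur).
  rewrite horner_p_poly_P_vec // -continuant_rotate; set x := iter k _ _.
  set v := (continuant _ _ _).[_].
  rewrite !exprMn -exprM mulnC exprM sqr_i rmorphXn rmorphN rmorph1.
  transitivity (((-1) ^+ n.+1 * (-1) ^+ n.+1) * (-1 * (x ^+ 2 * v ^+ 2)) : C); first by ring.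
  by rewrite -exprD addnn -mul2n exprM sqrrN !expr1n mul1r.
by rewrite ncX ncM nci mul1r lerXn2r ?nnegrE ?nc_ge0 // (le_trans (nc_ge0 _) (hM k)).
Qed.

End FilledJulia.

Theorem corollary5p6 (R : realType) (m : nat) (hm : (2 <= m)%N) :
  filled_julia (P_poly R m) `<=` Sigma_pi R /\
  filled_julia (Pstar_poly R m) `<=` Sigma_pi R.
Proof.
split; apply: subset_trans (@eigen_closure_Sigma_pi R).
  exact: filled_julia_P.
exact: filled_julia_Pstar.
Qed.
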